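(* Let $\Phi$ be a classical reduced irreducible root system of rank $\geq 2$, $R$ a commutative ring, $\mathrm{St}_{\Phi}(R)$ the Steinberg group and $\{K_\alpha:\alpha\in\Phi\}$ the root subgroups of $\mathrm{St}_{\Phi}(R)$. If for every $\alpha\in\Phi$ the pair $(\mathrm{St}_{\Phi}(R),K_\alpha)$ has relative property $(F_{\mathcal{E}_{uc}})$, then $\mathrm{St}_{\Phi}(R)$ has property $(F_{\mathcal{E}_{uc}})$.
   Context: Groups are discrete. For a Banach space $\mathbb{E}$ and a subgroup $K<\Gamma$, $(\Gamma,K)$ has relative property $(F_{\mathbb{E}})$ if every affine isometric action of $\Gamma$ on $\mathbb{E}$ has a $K$-fixed point; $\Gamma$ has property $(F_{\mathbb{E}})$ if every affine isometric action of $\Gamma$ on $\mathbb{E}$ has a $\Gamma$-fixed point. For a class $\mathcal{E}$ of Banach spaces, (relative) property $(F_{\mathcal{E}})$ means (relative) property $(F_{\mathbb{E}})$ for every $\mathbb{E}\in\mathcal{E}$. $\mathcal{E}_{uc}$ is the class of all uniformly convex Banach spaces, where $\mathbb{E}$ is uniformly convex if there is $\delta:(0,2]\to(0,1]$ such that for all unit vectors $\xi,\eta$, $\|\xi-\eta\|\ge\varepsilon$ implies $\|\frac{\xi+\eta}{2}\|\le 1-\delta(\varepsilon)$. Root systems. A root system in a finite dimensional real vector space $E$ is a finite non-empty set $\Phi\subset E$ that spans $E$, does not contain $0$ and satisfies $\Phi=-\Phi$; its rank is $\dim E$. It is reduced if every line in $E$ contains at most two elements of $\Phi$; irreducible if there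 are no disjoint non-empty $\Phi_1,\Phi_2$ with $\Phi=\Phi_1\cup\Phi_2$ and $\mathrm{span}(\Phi_1)\cap\mathrm{span}(\Phi_2)=\{0\}$; classical if there is an inner product on $E$ such that $\frac{2(\alpha,\beta)}{(\beta,\beta)}\in\mathbb{Z}$ and $\alpha-\frac{2(\alpha,\beta)}{(\beta,\beta)}\beta\in\Phi$ for all $\alpha,\beta\in\Phi$. Steinberg group. $\mathrm{St}_\Phi(R)$ is the group generated by symbols $x_\alpha(p)$, $\alpha\in\Phi$, $p\in R$, subject to: (1) $x_\alpha(p_1)x_\alpha(p_2)=x_\alpha(p_1+p_2)$; (2) for all $\alpha,\beta\in\Phi$ with $\beta\ne-\alpha$ and all $p_1,p_2\in R$, $[x_\alpha(p_1),x_\beta(p_2)]=\prod_{i,j\ge1,\ i\alpha+j\beta\in\Phi}x_{i\alpha+j\beta}(C_{i,j}^{\alpha,\beta}p_1^ip_2^j)$, the product taken in order of increasing $i+j$, where $[g,h]=g^{-1}h^{-1}gh$ and $C_{i,j}^{\alpha,\beta}$ are the (integer) constants of the Chevalley commutator relation for Chevalley groups over fields, that is: fix a Chevalley basis of the complex simple Lie algebra $\mathfrak{g}$ of type $\Phi$, with root vectors $e_\gamma$ ($\gamma\in\Phi$), and put $y_\gamma(s)=\exp(s\,\mathrm{ad}\,e_\gamma)\in\mathrm{Aut}(\mathfrak{g})$ for $s\in\mathbb{C}$; then, for $\alpha,\beta\in\Phi$ with $\beta\neq\pm\alpha$, the $C_{i,j}^{\alpha,\beta}$ are the unique integers such that $[y_\alpha(s_1),y_\beta(s_2)]=\prod_{i,j\ge1,\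 i\alpha+j\beta\in\Phi}y_{i\alpha+j\beta}(C_{i,j}^{\alpha,\beta}s_1^is_2^j)$ for all $s_1,s_2\in\mathbb{C}$, the product taken in the same order. The root subgroups are $K_\alpha=\{x_\alpha(p):p\in R\}$. *)

(* Defs.v *)
From HB Require Import structures.
From mathcomp Require Import all_boot all_order all_algebra.
From mathcomp Require Import finmap complex.
From mathcomp Require Import all_classical all_reals all_analysis.

Set Implicit Arguments.
Unset Strict Implicit.
Unset Printing Implicit Defensive.

Import Order.TTheory GRing.Theory Num.Theory.
Import numFieldNormedType.Exports.

Local Open Scope ring_scope.

Section FixedPoints.
Variable R : realType.

Definition uniformly_convex (V : completeNormedModType R) : Prop :=
  exists delta : R -> R,
    (forall eps, 0 < eps <= 2 -> 0 < delta eps <= 1) /\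
    (forall eps, 0 < eps <= 2 -> forall u v : V, `|u| = 1 -> `|v| = 1 ->
       eps <= `|u - v| -> `|2^-1 *: (u + v)| <= 1 - delta eps).

Record affine_isometric_action (G : groupType) (V : completeNormedModType R)
    (rho : G -> V -> V) : Prop := AffineIsometricAction {
  aia_one : forall v, rho 1%g v = v;
  aia_mul : forall g h v, rho (g * h)%g v = rho g (rho h v);
  aia_affine : forall g, exists (pi : {linear V -> V}) (b : V),
    forall v, rho g v = pi v + b;
  aia_isometric : forall g u v, `|rho g u - rho g v| = `|u - v|
}.

Definition banach_class := completeNormedModType R -> Prop.

Definition relative_F (cE : banach_class) (G : groupType) (K : set G) : Prop :=
  forall V : completeNormedModType R, cE V ->
  forall rho : G -> V -> V, affine_isometric_action rho ->
  exists v : V, forall k, K k -> rho k v = v.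

Definition property_F (cE : banach_class) (G : groupType) : Prop :=
  forall V : completeNormedModType R, cE V ->
  forall rho : G -> V -> V, affine_isometric_action rho ->
  exists v : V, forall g, rho g v = v.

End FixedPoints.

Section RootSystems.
Variables (R : realType) (E : vectType R).
Implicit Types Phi : {fset E}.

Definition spanf (A : {fset E}) : {vspace E} := <<enum_fset A>>%VS.

Definition root_system Phi : Prop :=
  [/\ Phi != fset0, spanf Phi = fullv, 0 \notin Phi &
      forall a, (a \in Phi) = (- a \in Phi)].

Definition reduced Phi : Prop :=
  forall D : {vspace E}, \dim D = 1%N ->
  (#|` [fset a in Phi | a \in D]%fset| <= 2)%N.

Definition irreducible Phi : Prop :=
  ~ exists Phi1 Phi2 : {fset E},
      [/\ Phi1 != fset0, Phi2 != fset0, [disjoint Phi1 & Phi2]%fset,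
          Phi = (Phi1 `|` Phi2)%fset &
          (spanf Phi1 :&: spanf Phi2)%VS = 0%VS].

Definition cartan_number (ip : {dot E for idfun}) (a b : E) : R :=
  2 * ip a b / ip b b.

Definition crystallographic_for Phi (ip : {dot E for idfun}) : Prop :=
  forall a b, a \in Phi -> b \in Phi ->
    cartan_number ip a b \is a Num.int /\ a - cartan_number ip a b *: b \in Phi.

Definition classical Phi : Prop :=
  exists ip : {dot E for idfun}, crystallographic_for Phi ip.

Definition root_base Phi (Delta : seq Phi) : Prop :=
  basis_of fullv (map val Delta) /\
  forall a : Phi, exists c : Phi -> nat,
    val a = \sum_(d <- Delta) val d *+ c d \/
    val a = - \sum_(d <- Delta) val d *+ c d.

(* [s] lists, in order of increasing [i + j], the triples [(i, j, g)] with
   [i, j >= 1] and [g = i a + j b] a root.  Roots [g] with equal [i + j] may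
   appear in either order: this only happens for [2 a + b] and [a + 2 b] in
   type G2, whose root elements commute. *)
Definition root_combinations Phi (a b : Phi) (s : seq (nat * nat * Phi)) : Prop :=
  [/\ uniq s,
      forall i j g, ((i, j, g) \in s) =
        [&& (0 < i)%N, (0 < j)%N & val g == val a *+ i + val b *+ j] &
      sorted (fun t u => (t.1.1 + t.1.2 <= u.1.1 + u.1.2)%N) s].

End RootSystems.

Section LieAlgebras.
Variables (K : fieldType) (L : vectType K).

(* The bracket is [[x, y] = ad x y]; its bilinearity is built into the type. *)
Definition lie_bracket (ad : 'Hom(L, 'End(L))) : Prop :=
  (forall x, ad x x = 0) /\
  (forall x y z, ad x (ad y z) + ad y (ad z x) + ad z (ad x y) = 0).

Definition lie_simple (ad : 'Hom(L, 'End(L))) : Prop :=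
  (exists x y, ad x y != 0) /\
  (forall I : {vspace L}, (forall x y, y \in I -> ad x y \in I) ->
     I = 0%VS \/ I = fullv).

(* The second clause says that [H] is nilpotent, the third that [H] is its own
   normalizer. *)
Definition cartan_subalgebra (ad : 'Hom(L, 'End(L))) (H : {vspace L}) : Prop :=
  [/\ forall x y, x \in H -> y \in H -> ad x y \in H,
      exists n, forall (s : seq L) y, size s = n -> {subset s <= H} ->
        y \in H -> foldr (fun x z => ad x z) y s = 0 &
      forall x, (forall h, h \in H -> ad x h \in H) -> x \in H].

Definition root_vector (ad : 'Hom(L, 'End(L))) (H : {vspace L})
    (lam : 'Hom(subvs_of H, K^o)) (x : L) : Prop :=
  forall h : subvs_of H, ad (vsval h) x = lam h *: x.

Definition lie_root (ad : 'Hom(L, 'End(L))) (H : {vspace L})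
    (lam : 'Hom(subvs_of H, K^o)) : Prop :=
  lam != 0 /\ exists2 x : L, x != 0 & root_vector ad lam x.

Definition lfun_power (f : 'End(L)) (k : nat) : 'End(L) :=
  iter k (fun g => (f \o g)%VF) \1%VF.

(* The exponential of a nilpotent endomorphism [f]: then [f ^ (\dim L) = 0], so
   that the truncated sum is the whole exponential series. *)
Definition nilpotent_exp (f : 'End(L)) : 'End(L) :=
  \sum_(k < (\dim {:L}).+1) (k`!%:R)^-1 *: lfun_power f k.

Definition lfun_commutator (g h : 'End(L)) : 'End(L) :=
  (g^-1 \o (h^-1 \o (g \o h)))%VF.

End LieAlgebras.

Section ChevalleyConstants.
Variables (R : realType) (E : vectType R) (Phi : {fset E}).
Local Notation C := (R[i]).
Local Open Scope complex_scope.

(* [wt] is a real-linear isomorphism of [E] onto the real span of the roots of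
   [(L, H)], carrying [Phi] onto the set of these roots. *)
Definition lie_type (L : vectType C) (ad : 'Hom(L, 'End(L))) (H : {vspace L})
    (wt : E -> 'Hom(subvs_of H, C^o)) : Prop :=
  [/\ forall u v, wt (u + v) = wt u + wt v,
      forall (r : R) v, wt (r *: v) = r%:C *: wt v,
      injective wt &
      forall lam, lie_root ad lam <-> exists2 a, a \in Phi & lam = wt a].

(* [h a] is the coroot of [a], [e a] a root vector; the Cartan numbers do not
   depend on the choice of [ip]. In the last clause [p] is
   the largest integer such that [b - p a] is a root. *)
Record chevalley_basis (L : vectType C) (ad : 'Hom(L, 'End(L)))
    (H : {vspace L}) (wt : E -> 'Hom(subvs_of H, C^o))
    (Delta : seq Phi) (h e : Phi -> L) : Prop := ChevalleyBasis {
  cb_base : root_base Delta;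
  cb_basis : basis_of fullv (map h Delta ++ map e (enum {: Phi}));
  cb_cartan : forall a, h a \in H;
  cb_root_vector : forall a : Phi, root_vector ad (wt (val a)) (e a);
  cb_hh : forall a b, ad (h a) (h b) = 0;
  cb_he : forall ip, crystallographic_for Phi ip -> forall a b : Phi,
    ad (h a) (e b) = (cartan_number ip (val b) (val a))%:C *: e b;
  cb_opp : forall a b : Phi, val b = - val a -> ad (e a) (e b) = h a;
  cb_zero : forall a b : Phi, val b != - val a -> val a + val b \notin Phi ->
    ad (e a) (e b) = 0;
  cb_sum : forall a b g : Phi, val g = val a + val b ->
    exists p : nat,
      [/\ val b - val a *+ p \in Phi,
          forall k : nat, (p < k)%N -> val b - val a *+ k \notin Phi &
          ad (e a) (e b) = p.+1%:R *: e g \/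
          ad (e a) (e b) = - (p.+1%:R *: e g)]
}.

Definition root_automorphism (L : vectType C) (ad : 'Hom(L, 'End(L)))
    (e : Phi -> L) (g : Phi) (s : C) : 'End(L) :=
  nilpotent_exp (s *: ad (e g)).

(* Only the values [c a b i j] with [b <> a], [b <> - a], [i, j >= 1] and
   [i a + j b] a root are constrained, and only these matter: when [Phi] is
   reduced, no [(i + j) a] with [i, j >= 1] is a root. *)
Definition commutator_formula (L : vectType C) (ad : 'Hom(L, 'End(L)))
    (e : Phi -> L) (c : Phi -> Phi -> nat -> nat -> int) : Prop :=
  forall a b : Phi, val b != val a -> val b != - val a ->
  forall s, root_combinations a b s -> forall s1 s2 : C,
  lfun_commutator (root_automorphism ad e a s1) (root_automorphism ad e b s2) =
  \big[(fun f g => (f \o g)%VF) / \1%VF]_(t <- s)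
    root_automorphism ad e t.2
      ((c a b t.1.1 t.1.2)%:~R * s1 ^+ t.1.1 * s2 ^+ t.1.2).

Definition chevalley_constants (c : Phi -> Phi -> nat -> nat -> int) : Prop :=
  exists (L : vectType C) (ad : 'Hom(L, 'End(L))) (H : {vspace L})
         (wt : E -> 'Hom(subvs_of H, C^o)) (Delta : seq Phi) (h e : Phi -> L),
    lie_bracket ad /\ lie_simple ad /\ cartan_subalgebra ad H /\
    lie_type ad wt /\ chevalley_basis ad wt Delta h e /\
    commutator_formula ad e c.

End ChevalleyConstants.

Section Presentation.
Variable X : choiceType.

(* The letter [(x, false)] is the generator [x], and [(x, true)] its inverse. *)
Definition word := seq (X * bool).

HB.instance Definition _ := Choice.on word.

Definition inv_letter (l : X * bool) : X * bool := (l.1, ~~ l.2).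
Definition inv_word (w : word) : word := rev (map inv_letter w).

Variable rel : word -> word -> Prop.

Inductive word_eq : word -> word -> Prop :=
| WordRel u v : rel u v -> word_eq u v
| WordCancel l : word_eq [:: l; inv_letter l] [::]
| WordCat u u' v v' : word_eq u u' -> word_eq v v' -> word_eq (u ++ v) (u' ++ v')
| WordRefl u : word_eq u u
| WordSym u v : word_eq u v -> word_eq v u
| WordTrans u v w : word_eq u v -> word_eq v w -> word_eq u w.

Definition word_eqb (u v : word) : bool := `[< word_eq u v >].

Lemma word_eqb_equiv : equiv_class_of word_eqb.
Proof.
split.
- by move=> u; apply/asboolP; exact: WordRefl.
- by move=> u v; apply/asboolP/asboolP; exact: WordSym.
- move=> v u w /asboolP uv /asboolP vw; apply/asboolP.
  exact: WordTrans uv vw.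
Qed.

Canonical word_equiv := EquivRelPack word_eqb_equiv.

Definition presented := {eq_quot word_equiv}%qT.

HB.instance Definition _ := Choice.on presented.

Definition pr (w : word) : presented := \pi_presented%qT w.

Lemma prP (u v : word) : pr u = pr v <-> word_eq u v.
Proof.
split=> [/eqmodP /asboolP //|uv].
by apply/eqmodP/asboolP.
Qed.

Lemma repr_pr (w : word) : word_eq (repr (pr w)) w.
Proof. by apply/prP; rewrite /pr reprK. Qed.

Lemma pr_repr (x : presented) : pr (repr x) = x.
Proof. exact: reprK. Qed.

Lemma inv_letterK : involutive inv_letter.
Proof. by case=> x b; rewrite /inv_letter /= negbK. Qed.

Lemma inv_word_cat u v : inv_word (u ++ v) = inv_word v ++ inv_word u.
Proof. by rewrite /inv_word map_cat rev_cat. Qed.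

Lemma inv_wordK : involutive inv_word.
Proof.
move=> w; rewrite /inv_word map_rev revK -map_comp.
by rewrite (eq_map inv_letterK) map_id.
Qed.

Lemma word_eq_mulV w : word_eq (w ++ inv_word w) [::].
Proof.
elim: w => [|l w IH]; first exact: WordRefl.
rewrite -cat1s inv_word_cat -catA (catA w).
apply: WordTrans (WordCancel l).
apply: (@WordCat [:: l] [:: l]); first exact: WordRefl.
exact: (WordCat IH (WordRefl _)).
Qed.

Lemma word_eq_mulr u v w : word_eq u v -> word_eq (u ++ w) (v ++ w).
Proof. by move=> uv; apply: WordCat uv (WordRefl w). Qed.

Lemma word_eq_mull u v w : word_eq u v -> word_eq (w ++ u) (w ++ v).
Proof. by move=> uv; apply: WordCat (WordRefl w) uv. Qed.

Lemma word_eq_inv u v : word_eq u v -> word_eq (inv_word u) (inv_word v).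
Proof.
move=> uv; apply: (@WordTrans _ (inv_word u ++ (v ++ inv_word v))).
  by rewrite -[X in word_eq X]cats0; apply/word_eq_mull/WordSym/word_eq_mulV.
rewrite catA -[X in word_eq _ X]cat0s; apply: word_eq_mulr.
apply: (@WordTrans _ (inv_word u ++ u)); first exact/word_eq_mull/WordSym.
by rewrite -{2}[u]inv_wordK; exact: word_eq_mulV.
Qed.

Definition presented_one : presented := pr [::].
Definition presented_mul (x y : presented) : presented := pr (repr x ++ repr y).
Definition presented_inv (x : presented) : presented := pr (inv_word (repr x)).

Lemma pr_mul u v : presented_mul (pr u) (pr v) = pr (u ++ v).
Proof. by apply/prP/WordCat; exact: repr_pr. Qed.

Lemma pr_inv u : presented_inv (pr u) = pr (inv_word u).
Proof. by apply/prP/word_eq_inv/repr_pr. Qed.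

Lemma presented_mulA : associative presented_mul.
Proof.
move=> x y z; rewrite -[x]pr_repr -[y]pr_repr -[z]pr_repr.
by rewrite !pr_mul catA.
Qed.

Lemma presented_mul1 : left_id presented_one presented_mul.
Proof. by move=> x; rewrite -[x]pr_repr pr_mul. Qed.

Lemma presented_mulr1 : right_id presented_one presented_mul.
Proof. by move=> x; rewrite -[x]pr_repr pr_mul cats0. Qed.

Lemma presented_mulV : left_inverse presented_one presented_inv presented_mul.
Proof.
move=> x; rewrite -[x]pr_repr pr_inv pr_mul; apply/prP.
by rewrite -{2}[repr x]inv_wordK; exact: word_eq_mulV.
Qed.

Lemma presented_mulrV : right_inverse presented_one presented_inv presented_mul.
Proof.
by move=> x; rewrite -[x]pr_repr pr_inv pr_mul; apply/prP; exact: word_eq_mulV.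
Qed.

HB.instance Definition _ := isGroup.Build presented presented_mulA
  presented_mul1 presented_mulr1 presented_mulV presented_mulrV.

End Presentation.

Section Steinberg.
Variables (R : realType) (E : vectType R) (Phi : {fset E}).
Variable c : Phi -> Phi -> nat -> nat -> int.
Variable A : comPzRingType.

Definition root_letter (a : Phi) (p : A) : word (Phi * A)%type :=
  [:: ((a, p), false)].

Inductive steinberg_rel : word (Phi * A)%type -> word (Phi * A)%type -> Prop :=
| SteinbergAdd a p1 p2 :
    steinberg_rel (root_letter a p1 ++ root_letter a p2)
                  (root_letter a (p1 + p2))
| SteinbergComm (a b : Phi) p1 p2 s :
    val b != - val a -> root_combinations a b s ->
    steinberg_rel
      (inv_word (root_letter a p1) ++ inv_word (root_letter b p2) ++
       root_letter a p1 ++ root_letter b p2)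
      (flatten [seq root_letter t.2
                  ((c a b t.1.1 t.1.2)%:~R * p1 ^+ t.1.1 * p2 ^+ t.1.2)
               | t <- s]).

Definition Steinberg : groupType := presented steinberg_rel.

Definition root_elt (a : Phi) (p : A) : Steinberg :=
  pr steinberg_rel (root_letter a p).

Definition root_subgroup (a : Phi) : set Steinberg :=
  [set g | exists p : A, g = root_elt a p].

End Steinberg.

(* Main.v *)
Require Import Defs.
From mathcomp Require Import all_boot all_order all_algebra.
From mathcomp Require Import finmap complex.
From mathcomp Require Import all_classical all_reals all_analysis.
From mathcomp Require Import ring lra zify.

(** The idea.  Let the Steinberg group act by affine isometries on a uniformly
    convex space.  For a linear functional [f] on the space of the roots, let
    [U_f] be the group generated by the root subgroups [K_a] with [f a > 0].  It
    has fixed points, because the [K_a] can be adjoined one at a time, each one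
    normalizing the previous ones and having bounded orbits
    ([fixed_by_positive]).

    Consider a functional [f] in general position on the hyperplane orthogonal
    to a root [b], so that [f] vanishes on [b] and [- b] only, and suppose that
    the distance between the fixed sets of [U_f] and of [U_(- f)] is attained by
    a pair [(u, v)].  An element [l] of [K_b] normalizes both groups, so
    [(l u, l v)] is another such pair, and strict convexity gives
    [l u - u = l v - v].  This vector is invariant under the linear parts of
    [U_f] and of [U_(- f)].  If [K_b] is contained in the group that they
    generate, it is also invariant under [l], so that [l^n u = u + n (l u - u)];
    as the orbits of [K_b] are bounded, [l u = u] and [l v = v].  So [u] and [v]
    are fixed by all [K_a] with [f a >= 0], respectively [f a <= 0].  These
    include the unipotent groups of every functional that is not separated from
    [f] by a root.  Thus the minimal distance is the same at neighbouring walls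
    and the same pair attains it.  The points where a generic line crosses the
    walls form a chain of neighbours that meets the wall of each root
    ([wall_functionals]), and [u] is fixed by the whole group.

    The distance need not be attained, and each step is carried out with an error
    that uniform convexity controls ([wall_almost_fixed],
    [nearly_minimal_step]).  The outcome is that near a point that the root
    elements displace by at most [d] there is a point that they displace by at
    most [d / 2], at a distance bounded by a constant multiple of [d]
    ([displacement_halving]).  Iteration converges to a fixed point.

    The inclusion of [K_b] in the group generated by [U_f] and [U_(- f)] is where
    the commutator constants enter.  Some root [g] other than [b] and [- b] is
    not orthogonal to [b].  Up to the sign of [g], one has [b = b0 + j g] with
    [j > 0] and [b0] the origin of the [g]-string through [b].  The
    constant in the factor of root [b] in the commutator of [x_b0] and [x_g] is
    then a sign ([string_constant]), as one sees by applying the commutator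
    formula to a vector of the Cartan subalgebra.  So [x_b p] is a word of
    bounded length in elements of other root subgroups ([steinberg_core]). *)

Set Implicit Arguments.
Unset Strict Implicit.
Unset Printing Implicit Defensive.

Import Order.TTheory GRing.Theory Num.Theory.
Import numFieldNormedType.Exports.

Local Open Scope classical_set_scope.
Local Open Scope ring_scope.

(** * Uniformly convex spaces *)

Section UniformConvexity.
Variables (R : realType) (V : completeNormedModType R).
Hypothesis ucV : uniformly_convex V.

(** If one of the vectors is short, then so is the sum.  Otherwise both are
    close to the unit sphere, and normalizing them loses little of their
    distance. *)
Lemma uniform_convexity_unit_ball (e : R) : 0 < e -> e <= 1 ->
  exists2 th : R, 0 < th & forall u v : V, `|u| <= `|v| -> `|v| <= 1 ->
    e <= `|u - v| -> `|u + v| <= 2 * (1 - th).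
Proof.
move=> e0 e1; have [dl [dl01 dlP]] := ucV.
have /andP[d0 d1] : 0 < dl (e / 2) <= 1 by apply: dl01; apply/andP; split; lra.
set d := dl (e / 2) in d0 d1.
exists (Num.min (e / 8) (d / 2)).
  by rewrite lt_min; apply/andP; split; lra.
move=> u v uv v1 euv.
have [ul|ul] := leP `|u| (1 - e / 4).
  apply: le_trans (ler_normD _ _) _.
  have : Num.min (e / 8) (d / 2) <= e / 8 by rewrite ge_min lexx.
  lra.
have normalize (w : V) : 0 < `|w| -> exists2 w' : V, `|w'| = 1 & w = `|w| *: w'.
  move=> w0; exists (`|w|^-1 *: w).
    by rewrite normrZ normfV normr_id mulVf // gt_eqF.
  by rewrite scalerA divff ?scale1r // gt_eqF.
have [u' nu' du] : exists2 u' : V, `|u'| = 1 & u = `|u| *: u'.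
  by apply: normalize; lra.
have [v' nv' dv] : exists2 v' : V, `|v'| = 1 & v = `|v| *: v'.
  by apply: normalize; lra.
have duu : `|u - u'| = 1 - `|u|.
  rewrite {1}du -[X in _ - X]scale1r -scalerBl normrZ nu' mulr1 distrC.
  by rewrite ger0_norm //; lra.
have dvv : `|v - v'| = 1 - `|v|.
  rewrite {1}dv -[X in _ - X]scale1r -scalerBl normrZ nv' mulr1 distrC.
  by rewrite ger0_norm //; lra.
have far : e / 2 <= `|u' - v'|.
  have t1 : `|u - v| <= `|u - u'| + `|u' - v'| + `|v' - v|.
    apply: le_trans (ler_distD v' _ _) _; rewrite lerD2r; exact: ler_distD.
  move: t1; rewrite [in X in _ <= X](distrC v' v) duu dvv => t1.
  lra.
have /dlP/(_ _ _ nu' nv' far) mid : 0 < e / 2 <= 2 by apply/andP; split; lra.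
rewrite -/d normrZ ger0_norm ?invr_ge0 // in mid.
have mid' : `|u' + v'| <= 2 * (1 - d) by lra.
have -> : u + v = `|u| *: (u' + v') + (`|v| - `|u|) *: v'.
  by rewrite scalerDr scalerBl -addrA [_ + (_ - _)]addrC subrK -du -dv.
apply: le_trans (ler_normD _ _) _.
rewrite !normrZ normr_id nv' mulr1 (@ger0_norm _ (`|v| - `|u|)) ?subr_ge0 //.
have u0 : 0 < `|u| by lra.
have h1 : `|u| * `|u' + v'| <= `|u| * (2 * (1 - d)) by rewrite ler_pM2l.
have h2 : Num.min (e / 8) (d / 2) <= d / 2 by rewrite ge_min lexx orbT.
have h3 : 3 / 4 * d <= `|u| * d by apply: ler_wpM2r; lra.
lra.
Qed.

Lemma uniform_convexity_ball (e : R) : 0 < e ->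
  exists2 th : R, 0 < th & forall (r : R) (u v : V), `|u| <= r -> `|v| <= r ->
    e * r <= `|u - v| -> `|u + v| <= 2 * (1 - th) * r.
Proof.
move=> e0; pose e' := Num.min e 1.
have e'0 : 0 < e' by rewrite lt_min e0 ltr01.
have e'1 : e' <= 1 by rewrite ge_min lexx orbT.
have [th th0 thP] := uniform_convexity_unit_ball e'0 e'1.
exists th => // r u v ur vr.
have [r0|r0] := leP r 0.
  have u0 : `|u| = 0 by apply/eqP; rewrite eq_le normr_ge0 andbT (le_trans ur).
  have v0 : `|v| = 0 by apply/eqP; rewrite eq_le normr_ge0 andbT (le_trans vr).
  have -> : r = 0 by apply/eqP; rewrite eq_le r0 -u0.
  by move=> _; rewrite mulr0 (normr0_eq0 u0) (normr0_eq0 v0) addr0 normr0.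
wlog uv : u v ur vr / `|u| <= `|v|.
  move=> H euv; have [uv|/ltW vu] := leP `|u| `|v|; first exact: H.
  by rewrite addrC; apply: H => //; rewrite distrC.
move=> euv; have rV : 0 < r^-1 by rewrite invr_gt0.
have sc (w : V) : `|r^-1 *: w| = `|w| / r by rewrite normrZ gtr0_norm // mulrC.
have := thP (r^-1 *: u) (r^-1 *: v).
rewrite -scalerBr -scalerDr !sc ler_pM2r // uv ler_pdivrMr // mul1r vr.
rewrite ler_pdivlMr // ler_pdivrMr //; apply=> //.
apply: le_trans euv; rewrite ler_pM2r // ge_min lexx //.
Qed.

(** The same norm bound is available for vectors of any size at the cost of an
    absolute error: short vectors are close to each other for trivial
    reasons. *)
Lemma close_of_long_midpoint (C e : R) : 0 < C -> 0 < e ->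
  exists2 th : R, 0 < th & forall (d : R) (u v : V), 0 < d ->
    `|u| <= C * d -> `|v| = `|u| -> 2 * (`|u| - th * d) <= `|u + v| ->
    `|u - v| <= e * d.
Proof.
move=> C0 e0; have eC : 0 < e / C by rewrite divr_gt0.
have [th th0 thP] := uniform_convexity_ball eC.
exists (th * (e / 4)); first by rewrite !mulr_gt0 // divr_gt0.
move=> d u v d0 uC vu mid; rewrite leNgt; apply/negP => far.
have du : e * d < 2 * `|u|.
  apply: lt_le_trans far _; apply: le_trans (ler_normB _ _) _.
  by rewrite vu; lra.
have ed : 0 < e * d by rewrite mulr_gt0.
have h : e / C * `|u| <= `|u - v|.
  apply: ltW; apply: le_lt_trans far.
  by rewrite mulrAC ler_pdivrMr // -mulrA ler_pM2l // mulrC.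
have vu' : `|v| <= `|u| by rewrite vu.
have := thP _ _ _ (lexx _) vu' h.
have : th * (e * d) < th * (2 * `|u|) by rewrite ltr_pM2l.
have : 0 < th * (e * d) by rewrite mulr_gt0.
nra.
Qed.

Lemma cauchy_limit (z : nat -> V) :
  (forall e : R, 0 < e -> exists N, forall m n, (N <= m)%N -> (N <= n)%N ->
     `|z m - z n| <= e) ->
  exists l, forall e : R, 0 < e -> exists N, forall n, (N <= n)%N ->
     `|l - z n| <= e.
Proof.
move=> zC; have : cauchy (z @ \oo).
  apply/cauchy_ballP => e e0.
  have [N NP] := zC (e / 2) (divr_gt0 e0 (ltr0n _ 2)).
  exists (z @` [set n | (N <= n)%N], z @` [set n | (N <= n)%N])%classic => /=.
    by split; exists N => // n /= Nn; exists n.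
  move=> [_ _] /= [[m Nm <-] [n Nn <-]]; rewrite -ball_normE /=.
  by apply: le_lt_trans (NP m n Nm Nn) _; rewrite ltr_pdivrMr // ltr_pMr // ltr1n.
move=> /cauchy_cvg zc; exists (lim (z @ \oo)) => e e0.
have /cvgrPdist_le /(_ e e0) [N _ NP] := zc.
by exists N => n Nn; exact: NP.
Qed.

(** The centre of a bounded set: the centre of the smallest ball that contains
    it.  Uniform convexity makes almost minimal balls almost concentric, which
    gives existence by completeness, and uniqueness. *)
Lemma circumcenter (O : set V) (o : V) (r : R) : O o ->
  (forall a, O a -> `|o - a| <= r) ->
  exists z, `|z - o| <= r /\
    forall phi : V -> V, (forall u v, `|phi u - phi v| = `|u - v|) ->
      (forall a, O a -> exists2 b, O b & phi b = a) -> phi z = z.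
Proof.
move=> Oo Or.
pose P : set R := [set s | exists z, forall a, O a -> `|z - a| <= s]%classic.
have P0 : lbound P 0 by move=> s [z /(_ o Oo)]; apply: le_trans.
have Pr : P r by exists o.
pose rho := inf P.
have Pinf : has_inf P by split; [exists r | exists 0].
have rho0 : 0 <= rho by apply: lb_le_inf => //; exists r.
have concentric (e : R) : 0 < e -> exists2 s : R, 0 < s & forall z z',
    (forall a, O a -> `|z - a| <= rho + s) ->
    (forall a, O a -> `|z' - a| <= rho + s) -> `|z - z'| <= e.
  move=> e0; have erho : 0 < e / (rho + 1) by apply: divr_gt0 => //; lra.
  have [th th0 thP] := uniform_convexity_ball erho.
  (* If the centres were more than [e] apart, the radius [rho + s] would exceed
     [e / 2], and their midpoint would lower it by [th * e / 2] at least. *)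
  exists (Num.min 1 (th * e / 4)).
    by rewrite lt_min ltr01 /= divr_gt0 // mulr_gt0.
  set s := Num.min _ _ => z z' zs zs'.
  have s1 : s <= 1 by rewrite ge_min lexx.
  have s2 : s <= th * e / 4 by rewrite ge_min lexx orbT.
  rewrite leNgt; apply/negP => far.
  have big : e < 2 * (rho + s).
    apply: lt_le_trans far _; apply: le_trans (ler_distD o _ _) _.
    by rewrite (distrC o z') mulr_natl mulr2n lerD // ?zs // zs'.
  have : rho <= (1 - th) * (rho + s).
    apply: ge_inf; first by exists 0.
    exists (2^-1 *: (z + z')) => a Oa.
    have -> : 2^-1 *: (z + z') - a = 2^-1 *: ((z - a) + (z' - a)).
      rewrite addrACA -opprD -mulr2n -[a *+ 2]scaler_nat scalerBr.
      by rewrite scalerA mulVf ?scale1r.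
    rewrite normrZ ger0_norm ?invr_ge0 //.
    have := thP (rho + s) (z - a) (z' - a) (zs _ Oa) (zs' _ Oa).
    rewrite opprB addrA subrK => h.
    have : `|z - a + (z' - a)| <= 2 * (1 - th) * (rho + s).
      apply: h; apply: le_trans (ltW far).
      rewrite mulrAC ler_pdivrMr; last by lra.
      by rewrite ler_pM2l //; lra.
    rewrite ler_pdivrMl //; lra.
  have : th * e < th * (2 * (rho + s)) by rewrite ltr_pM2l.
  have : 0 < th * e by rewrite mulr_gt0.
  nra.
have almost (s : R) : 0 < s -> exists z, forall a, O a -> `|z - a| <= rho + s.
  move=> s0; have [t [z zt] ts] := inf_adherent s0 Pinf.
  by exists z => a /zt h; apply: le_trans h (ltW ts).
have almostn (n : nat) : exists z, forall a, O a -> `|z - a| <= rho + n.+1%:R^-1.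
  by apply: almost; rewrite invr_gt0.
have [z zP] := choice almostn.
have zle n (s : R) : 0 < s -> (Num.bound s^-1 <= n)%N ->
    forall a, O a -> `|z n - a| <= rho + s.
  move=> s0 sn a Oa; apply: le_trans (zP n a Oa) _; rewrite lerD2l.
  rewrite -[s]invrK lef_pV2 ?posrE ?invr_gt0 //.
  apply: le_trans (ltW (archi_boundP _)) _; first by rewrite invr_ge0 ltW.
  by rewrite ler_nat (leq_trans sn).
have [c cP] : exists l, forall e : R, 0 < e -> exists N, forall n, (N <= n)%N ->
     `|l - z n| <= e.
  apply: cauchy_limit => e e0; have [s s0 sP] := concentric e e0.
  by exists (Num.bound s^-1) => m n Nm Nn; apply: sP; exact: zle.
have cO a : O a -> `|c - a| <= rho.
  move=> Oa; apply/ler_addgt0Pr => e e0.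
  have e2 : 0 < e / 2 by apply: divr_gt0.
  have [N NP] := cP _ e2.
  pose n := maxn N (Num.bound (e / 2)^-1).
  apply: le_trans (ler_distD (z n) _ _) _.
  have := NP n (leq_maxl _ _); have := zle n _ e2 (leq_maxr _ _) a Oa; lra.
exists c; split.
  by apply: le_trans (cO _ Oo) _; apply: ge_inf => //; exists 0.
move=> phi iso perm.
apply/eqP; rewrite -subr_eq0 -normr_le0; apply/ler_addgt0Pr => e e0.
rewrite add0r; have [s s0 sP] := concentric e e0.
apply: sP => a Oa; last by apply: le_trans (cO _ Oa) _; rewrite lerDl ltW.
have [b Ob <-] := perm a Oa; rewrite iso.
by apply: le_trans (cO _ Ob) _; rewrite lerDl ltW.
Qed.

End UniformConvexity.

(** * Generic linear functionals on a root system *)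

Section GenericFunctionals.
Variables (R : realType) (E : vectType R).

Lemma functional_nonzero (v : E) : v != 0 -> exists f : 'Hom(E, R^o), f v != 0.
Proof.
move=> v0; pose b := vbasis (fullv : {vspace E}).
have [i vi] : exists i, coord b i v != 0.
  apply/existsP; apply: contra_neqT v0 => /existsPn v0.
  rewrite (coord_vbasis (memvf v)) big1 // => i _.
  by move/negbNE/eqP: (v0 i) => ->; rewrite scale0r.
by exists (linfun (coord b i)); rewrite lfunE.
Qed.

Lemma natmul_vector_inj (v : E) : v != 0 -> injective (GRing.natmul v).
Proof.
move=> v0 m n /eqP; rewrite -(scaler_nat m) -(scaler_nat n) -subr_eq0 -scalerBl.
by rewrite scaler_eq0 (negPf v0) orbF subr_eq0 eqr_nat => /eqP.
Qed.

Lemma fresh_scalar (s : seq R) : exists t, t \notin s.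
Proof.
exists (1 + \sum_(r <- s) `|r|); apply/negP => st.
have : 1 + \sum_(r <- s) `|r| <= \sum_(r <- s) `|r|.
  apply: le_trans (ler_norm _) _.
  rewrite [X in _ <= X](big_rem _ st) /= lerDl.
  by apply: sumr_ge0.
by rewrite gerDr leNgt ltr01.
Qed.

(** If [f] works for all vectors but one and [g] for the last one, then
    [f + t *: g] works for all but finitely many [t]. *)
Lemma generic_functional (s : seq E) : 0 \notin s ->
  exists f : 'Hom(E, R^o), forall v, v \in s -> f v != 0.
Proof.
elim: s => [|v s IH]; first by exists 0.
rewrite inE negb_or eq_sym => /andP[v0 /IH[f fs]].
have [fv|fv] := eqVneq (f v) 0; last first.
  by exists f => w; rewrite inE => /predU1P[->|/fs].
have [g gv] := functional_nonzero v0.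
have [t] := fresh_scalar (0 :: [seq - f w / g w | w <- s]).
rewrite inE negb_or => /andP[t0 ts].
exists (f + t *: g) => w; rewrite inE add_lfunE scale_lfunE.
move=> /predU1P[->|ws]; first by rewrite fv add0r mulf_neq0.
have [gw|gw] := eqVneq (g w) 0; first by rewrite gw scaler0 addr0 fs.
apply: contraNneq ts => /eqP; rewrite addrC addr_eq0 => /eqP tg.
by apply/mapP; exists w => //; rewrite -tg -[_ *: _]/(t * _) mulfK.
Qed.

Variable Phi : {fset E}.

Definition one_per_line := forall a b : Phi, forall r : R,
  val b = r *: val a -> val b = val a \/ val b = - val a.

Hypothesis Phi0 : 0 \notin Phi.
Hypothesis PhiL : one_per_line.

Lemma root_neq0 (a : Phi) : val a != 0.
Proof. by apply: contraNneq Phi0 => <-; exact: valP. Qed.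

(** The quotient [f0 / f1] takes the same value at [a] and [b] exactly when
    [f0] vanishes at [f1 b *: a - f1 a *: b], a vector that is zero for
    proportional roots only. *)
Lemma generic_pencil : exists f0 f1 : 'Hom(E, R^o),
  (forall a : Phi, f1 (val a) != 0) /\
  forall a b : Phi, f0 (val a) / f1 (val a) = f0 (val b) / f1 (val b) ->
    val b = val a \/ val b = - val a.
Proof.
have [f1 f1P] := generic_functional Phi0.
have f1n (a : Phi) : f1 (val a) != 0 by exact/f1P/valP.
pose w (ab : Phi * Phi) :=
  f1 (val ab.2) *: val ab.1 - f1 (val ab.1) *: val ab.2.
have [|f0 f0P] :=
  @generic_functional [seq w ab | ab <- enum {: Phi * Phi} & w ab != 0].
  by apply/negP => /mapP[ab]; rewrite mem_filter => /andP[/eqP + _] /esym.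
exists f0, f1; split=> // a b eab.
have [wab|wab] := eqVneq (w (a, b)) 0; last first.
  have /negP[] : f0 (w (a, b)) != 0.
    by apply: f0P; apply: map_f; rewrite mem_filter wab mem_enum.
  rewrite /w /= linearB !linearZ /= scalerN subr_eq0; apply/eqP.
  rewrite -[LHS]/(_ * _) -[RHS]/(_ * _).
  by move/eqP: eab; rewrite eqr_div // => /eqP e; rewrite mulrC e mulrC.
apply: (PhiL (r := f1 (val b) / f1 (val a))).
move/eqP: wab; rewrite subr_eq0 /= => /eqP h.
by rewrite mulrC -scalerA h scalerA (mulVf (f1n a)) scale1r.
Qed.

(** A functional [f a] for each root [a], vanishing on the roots [a] and [- a]
    only, such that any two of these functionals are linked by a chain in which
    no root is positive at one step and negative at the next one.  The
    functionals are the points at which a generic line in the dual space crosses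
    the hyperplanes orthogonal to the roots; neighbours on the line are not
    separated by any root. *)
Lemma wall_functionals : exists f : Phi -> 'Hom(E, R^o),
  (forall a b : Phi, f a (val b) = 0 <-> val b = val a \/ val b = - val a) /\
  forall a b : Phi,
    connect (fun a b => [forall c : Phi, 0 <= f a (val c) * f b (val c)]) a b.
Proof.
have [f0 [f1 [f1n sep]]] := generic_pencil.
pose psi (a : Phi) : R := f0 (val a) / f1 (val a).
exists (fun a => f0 - psi a *: f1).
have fE (a b : Phi) :
    (f0 - psi a *: f1) (val b) = f1 (val b) * (psi b - psi a).
  rewrite add_lfunE opp_lfunE scale_lfunE mulrBr [in RHS]mulrC (divfK (f1n b)).
  by rewrite [f1 _ * _]mulrC.
split=> [a b|a b].
  rewrite fE; split=> [/eqP|[] e].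
  - rewrite mulf_eq0 (negPf (f1n b)) /= subr_eq0 => /eqP/esym; exact: sep.
  - by have -> : b = a; [exact: val_inj | rewrite subrr mulr0].
  - rewrite /psi e !linearN /= invrN mulrNN subrr mulr0 //.
set adj := fun a b : Phi => _.
have adjC : connect_sym adj.
  apply: sym_connect_sym => c c'; apply: eq_forallb => e.
  by rewrite mulrC.
wlog ab : a b / psi a <= psi b.
  by move=> H; have [/H//|/ltW/H] := leP (psi a) (psi b); rewrite adjC.
have [n] := ubnP #|[pred c | psi a < psi c < psi b]|.
elim: n a b ab => // n IH a b ab; rewrite ltnS => abn.
have [c abc|none] := pickP [pred c | psi a < psi c < psi b].
  have /andP[ac cb] := abc.
  apply: (@connect_trans _ _ c); apply: IH; rewrite ?ltW //.
    apply: leq_trans abn; apply: proper_card; apply/properP; split.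
      by apply/fintype.subsetP => e; rewrite !inE => /andP[-> /lt_trans->].
    by exists c; rewrite // !inE ltxx andbF.
  apply: leq_trans abn; apply: proper_card; apply/properP; split.
    by apply/fintype.subsetP => e; rewrite !inE => /andP[/(lt_trans ac)-> ->].
  by exists c; rewrite // !inE ltxx.
apply: connect1; apply/forallP => c; rewrite !fE mulrACA.
apply: mulr_ge0; first by rewrite -expr2 sqr_ge0.
have := none c; rewrite /= -/(psi c).
have [ca|ac] := leP (psi c) (psi a).
  by move=> _; apply: mulr_le0; rewrite subr_le0 // (le_trans ca).
have [cb|bc] := ltP (psi c) (psi b) => // _.
by apply: mulr_ge0; rewrite subr_ge0 // ltW.
Qed.

End GenericFunctionals.

(** * Affine isometric actions *)

Section Actions.
Variables (R : realType) (V : completeNormedModType R) (G : groupType).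
Variable rho : G -> V -> V.
Hypothesis rhoP : affine_isometric_action rho.

Definition linear_part (g : G) (v : V) : V := rho g v - rho g 0.

Lemma linear_partE g : exists pi : {linear V -> V},
  (forall v, linear_part g v = pi v) /\ forall v, rho g v = pi v + rho g 0.
Proof.
have [pi [b pib]] := aia_affine rhoP g; exists pi.
have b0 : rho g 0 = b by rewrite pib linear0 add0r.
by split=> v; rewrite ?/linear_part b0 pib ?addrK.
Qed.

Lemma linear_partB g u v : linear_part g (u - v) = rho g u - rho g v.
Proof.
have [pi [lE rE]] := linear_partE g.
by rewrite lE (rE u) (rE v) opprD addrACA subrr addr0 linearB.
Qed.

Lemma action_midpoint g u v :
  rho g (2^-1 *: (u + v)) = 2^-1 *: (rho g u + rho g v).
Proof.
have [pi [_ rE]] := linear_partE g.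
rewrite (rE (_ *: _)) (rE u) (rE v) linearZ linearD addrACA [in RHS]scalerDr.
congr (_ + _).
by rewrite -mulr2n -[rho g 0 *+ 2]scaler_nat scalerA mulVf ?scale1r.
Qed.

Lemma linear_partM g h v :
  linear_part (g * h)%g v = linear_part g (linear_part h v).
Proof. by rewrite /(linear_part h) linear_partB -!(aia_mul rhoP). Qed.

Definition almost_fixed (g : G) (v : V) (e : R) := `|rho g v - v| <= e.

Lemma almost_fixed_near g u v e s : almost_fixed g u e -> `|u - v| <= s ->
  almost_fixed g v (e + 2 * s).
Proof.
move=> ue uv; rewrite /almost_fixed.
have t1 := ler_distD (rho g u) (rho g v) v; have t2 := ler_distD u (rho g u) v.
have : `|rho g v - rho g u| <= s by rewrite (aia_isometric rhoP) distrC.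
by move: ue; rewrite /almost_fixed; lra.
Qed.

End Actions.

(** * Groups graded by a root system *)

Section GradedGroups.
Variables (R : realType) (E : vectType R) (Phi : {fset E}) (A : zmodType).
Variables (G : groupType) (x : Phi -> A -> G).

Definition root_word (w : seq (Phi * A)) : G :=
  (\big[*%g/1]_(t <- w) x t.1 t.2)%g.

(** The clause [sg_core] is what makes the grading strong: it excludes, for
    instance, a free product of two root subgroups [K_a] and [K_(- a)].  The
    bound on the length of the words serves to transport estimates from
    the other root subgroups to [K_a]. *)
Record strongly_graded : Prop := StronglyGraded {
  sg_add : forall a p q, x a (p + q) = (x a p * x a q)%g;
  sg_comm : forall (a b : Phi) p q, val b != val a -> val b != - val a ->
    exists w, (x b q * x a p = x a p * (x b q * root_word w))%g /\
      forall t, t \in w -> exists i j : nat,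
        [/\ (0 < i)%N, (0 < j)%N & val t.1 = val b *+ i + val a *+ j];
  sg_core : forall a, exists M : nat, forall p, exists w,
    [/\ (size w <= M)%N, x a p = root_word w &
      forall t, t \in w -> val t.1 != val a /\ val t.1 != - val a];
  sg_gen : forall g, exists w, g = root_word w
}.

Hypothesis xP : strongly_graded.

Lemma root_elt0 a : x a 0 = 1%g.
Proof.
by apply: (mulgI (x a 0)); rewrite -(sg_add xP) addr0 mulg1.
Qed.

Section FixedSets.
Variables (V : completeNormedModType R) (rho : G -> V -> V).
Hypothesis ucV : uniformly_convex V.
Hypothesis rhoP : affine_isometric_action rho.

Definition fixed_by (Psi : pred Phi) (v : V) :=
  forall a p, Psi a -> rho (x a p) v = v.

Definition displacement_le (v : V) (d : R) :=
  forall a p, almost_fixed rho (x a p) v d.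

Definition normalized_by (Psi : pred Phi) (a : Phi) :=
  forall b, Psi b -> [/\ val b != val a, val b != - val a &
    forall (c : Phi) (i j : nat), (0 < i)%N -> (0 < j)%N ->
      val c = val b *+ i + val a *+ j -> Psi c].

Lemma fixed_by_word Psi v w : fixed_by Psi v -> all (fun t => Psi t.1) w ->
  rho (root_word w) v = v.
Proof.
rewrite /root_word => vP; elim: w => [|t w IH] /=.
  by rewrite big_nil (aia_one rhoP).
by move=> /andP[t1 /IH wv]; rewrite big_cons (aia_mul rhoP) wv vP.
Qed.

Lemma fixed_by_midpoint Psi u v : fixed_by Psi u -> fixed_by Psi v ->
  fixed_by Psi (2^-1 *: (u + v)).
Proof. by move=> uP vP a p Pa; rewrite action_midpoint // uP // vP. Qed.

(** The commutators of [K_a] with the root subgroups of [Psi] are products of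
    elements of root subgroups of [Psi], so that [K_a] normalizes the group that
    these generate. *)
Lemma fixed_by_translate Psi a p v : normalized_by Psi a ->
  fixed_by Psi v -> fixed_by Psi (rho (x a p) v).
Proof.
move=> Na vP b q Pb; have [ba bNa Pc] := Na b Pb.
have [w [e wP]] := sg_comm xP p q ba bNa.
have wPsi : all (fun t => Psi t.1) w.
  by apply/allP => t /wP[i [j [i0 j0 tE]]]; exact: Pc tE.
by rewrite -(aia_mul rhoP) e !(aia_mul rhoP) (fixed_by_word vP wPsi) vP.
Qed.

(** A point fixed by [Psi] and almost fixed by a root subgroup that normalizes
    [Psi] is close to a point fixed by both, namely the centre of its orbit
    under that root subgroup. *)
Lemma fixed_by_extend Psi a v e : normalized_by Psi a -> fixed_by Psi v ->
  (forall p, almost_fixed rho (x a p) v e) ->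
  exists v', [/\ fixed_by Psi v', forall p, rho (x a p) v' = v' &
                 `|v' - v| <= e].
Proof.
move=> Na vP ve; pose O : set V := [set u | exists p, rho (x a p) v = u].
have Ov : O v by exists 0; rewrite root_elt0 (aia_one rhoP).
have Oe u : O u -> `|v - u| <= e by move=> [p <-]; rewrite distrC; exact: ve.
have [z [zv zfix]] := circumcenter ucV Ov Oe; exists z; split=> //.
  move=> b q Pb; apply: zfix; first exact: aia_isometric.
  move=> _ [p <-]; exists (rho (x a p) v); first by exists p.
  by apply: fixed_by_translate Pb.
move=> p; apply: zfix; first exact: aia_isometric.
move=> _ [q <-]; exists (rho (x a (q - p)) v); first by exists (q - p).
by rewrite -(aia_mul rhoP) -(sg_add xP) addrC subrK.
Qed.

Definition positive_part (f : 'Hom(E, R^o)) : pred Phi :=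
  fun a => (0 : R) < f (val a).

Lemma functional_combination (f : 'Hom(E, R^o)) (u v w : E) (i j : nat) :
  u = v *+ i + w *+ j -> f u = f v *+ i + f w *+ j :> R.
Proof. by move=> ->; rewrite linearD !linearMn. Qed.

(** Unipotent groups have fixed points: the root subgroups are adjoined in the
    order of decreasing values of [f], so that each one normalizes the
    preceding ones. *)
Lemma fixed_by_positive (f : 'Hom(E, R^o)) : exists2 C : R, 0 <= C &
  forall v d, displacement_le v d ->
    exists2 v', fixed_by (positive_part f) v' & `|v' - v| <= C * d.
Proof.
(* [Psi] runs through the upper segments of the positive part for [f]. *)
suff H n (Psi : pred Phi) : (#|Psi| <= n)%N -> subpred Psi (positive_part f) ->
    (forall b c, Psi b -> (f (val b) : R) < f (val c) -> Psi c) ->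
    exists2 C : R, 0 <= C & forall v d, displacement_le v d ->
      exists2 v', fixed_by Psi v' & `|v' - v| <= C * d.
  apply: (H _ _ (leqnn _)) => // b c fb; exact: lt_trans.
elim: n Psi => [|n IH] Psi Psin Psi0 Psiup.
  exists 0 => // v d _; exists v; last by rewrite subrr normr0 mul0r.
  move=> a p Pa; move: Psin; rewrite leqn0 => /eqP/card0_eq/(_ a).
  by rewrite unfold_in Pa.
have [b Pb|none] := pickP Psi; last first.
  exists 0 => // v d _; exists v; last by rewrite subrr normr0 mul0r.
  by move=> a p; rewrite none.
case: (arg_minP (fun a : Phi => f (val a) : R) Pb) => a Pa amin.
pose Psi' : pred Phi := [pred c | Psi c && (c != a)].
have fa0 : 0 < (f (val a) : R) by exact: Psi0.
have [|||C C0 CP] := IH Psi'.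
- rewrite -ltnS; apply: leq_trans Psin; apply: proper_card; apply/properP.
  split; first by apply/fintype.subsetP => c; rewrite !inE => /andP[].
  by exists a; rewrite ?inE ?eqxx ?andbF.
- by move=> c /andP[/Psi0].
- move=> c e /andP[Pc ca] ce; rewrite /Psi' /= (Psiup c) //=.
  by apply: contraTneq ce => ->; rewrite -leNgt amin.
(* Moving [v] by [C * d] raises its displacement to [(1 + 2 C) d], which bounds
   the last move. *)
exists (3 * C + 1); first by lra.
move=> v d vd; have [v' v'P v'v] := CP v d vd.
have [||p|u [uP ua uv']] := @fixed_by_extend Psi' a v' (d + 2 * (C * d)).
- move=> c /andP[Pc ca]; have c0 : 0 < (f (val c) : R) by exact: Psi0.
  split=> [||e i j i0 j0 eE]; first by rewrite (inj_eq val_inj).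
    by apply: contraTneq c0 => ->; rewrite linearN /= -leNgt oppr_le0 ltW.
  have fe := functional_combination f eE.
  have ce : (f (val c) : R) < f (val e).
    rewrite fe -[ltLHS]addr0 ler_ltD ?pmulrn_lgt0 //.
    by rewrite -[leLHS]mulr1n ler_wpMn2l // ltW.
  rewrite /Psi' /= (Psiup c) //=; apply: contraTneq ce => ->.
  by rewrite -leNgt amin.
- by [].
- by apply: (almost_fixed_near rhoP (vd a p)); rewrite distrC.
exists u; last first.
  by have := ler_distD v' u v; lra.
by move=> c p Pc; have [->//|ca] := eqVneq c a; apply: uP; rewrite /Psi' /= Pc.
Qed.

End FixedSets.
End GradedGroups.

(** * Pairs of almost minimal distance *)

Lemma uniform_positive (R : realType) (T : finType) (P : T -> R -> Prop) :
  (forall t k l, P t k -> 0 < l <= k -> P t l) ->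
  (forall t, exists2 k, 0 < k & P t k) -> exists2 k, 0 < k & forall t, P t k.
Proof.
move=> Panti Pex.
have /choice[k kP] t : exists k, 0 < k /\ P t k by have [k] := Pex t; exists k.
have m0 : 0 < \big[Order.min/1]_t k t.
  elim/big_ind: _ => [//|u v u0 v0|t _]; last by case: (kP t).
  by rewrite lt_min u0.
exists (\big[Order.min/1]_t k t) => // t; have [_ kt] := kP t.
by apply: Panti kt _; rewrite m0 bigmin_le_cond.
Qed.

Section Contraction.
Variables (R : realType) (E : vectType R) (Phi : {fset E}) (A : zmodType).
Variables (G : groupType) (x : Phi -> A -> G).
Hypothesis xP : strongly_graded x.
Variables (V : completeNormedModType R) (rho : G -> V -> V).
Hypothesis ucV : uniformly_convex V.
Hypothesis rhoP : affine_isometric_action rho.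

Local Notation fixed := (fixed_by x rho).
Local Notation lin := (linear_part rho).

Definition wall_functional (f : 'Hom(E, R^o)) := forall a b : Phi,
  f (val a) = 0 -> f (val b) = 0 -> val b = val a \/ val b = - val a.

Lemma wall_normalizes (f : 'Hom(E, R^o)) (a : Phi) :
  f (val a) = 0 -> normalized_by (positive_part f) a.
Proof.
rewrite /normalized_by /positive_part => fa b fb.
split=> [||c i j i0 j0 /(functional_combination f) ->].
- by apply: contraTneq fb => ->; rewrite fa ltxx.
- by apply: contraTneq fb => ->; rewrite linearN /= fa oppr0 ltxx.
- by rewrite fa mul0rn addr0 pmulrn_lgt0.
Qed.

Lemma linear_part_word (w : seq (Phi * A)) v (e : R) :
  (forall t, t \in w -> `|lin (x t.1 t.2) v - v| <= e) ->
  `|lin (root_word x w) v - v| <= e *+ size w.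
Proof.
rewrite /root_word; elim: w => [|t w IH] wv /=.
  by rewrite big_nil mulr0n /linear_part !(aia_one rhoP) subr0 subrr normr0.
rewrite big_cons linear_partM //.
apply: le_trans (ler_distD (lin (x t.1 t.2) v) _ _) _.
rewrite mulrSr; apply: lerD; last by apply: wv; rewrite mem_head.
rewrite {1 2}/linear_part opprB addrA subrK (aia_isometric rhoP).
by apply: IH => s sw; apply: wv; rewrite inE sw orbT.
Qed.

(** The second term keeps the minimization near [o], and costs little: an
    isometry that displaces [o] by at most [d] changes the spread of a pair by
    at most [t * d]. *)
Definition spread (t : R) (o u v : V) : R := `|u - v| + t * `|u - o|.

(** Let [(u, v)] almost minimize the spread among the pairs of points fixed by
    the opposite unipotent groups of [f] and of [- f].  Then [u] and [v] are
    almost fixed by the root subgroup [K_b] of the wall [f = 0]: as [K_b]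
    normalizes both groups, an element [l] of [K_b] yields another almost
    minimal pair, and the midpoint of the two pairs shows that [l u - u] and
    [l v - v] almost agree.  So [l u - u] is almost invariant under both
    unipotent groups, hence under [K_b], and [l^2 u - u] is almost
    [2 (l u - u)].  As the [K_b]-orbit of [u] is bounded, this forces
    [l u - u] to be small. *)
Lemma wall_almost_fixed (f : 'Hom(E, R^o)) (b : Phi) (C e : R) :
  wall_functional f -> f (val b) = 0 -> 0 < C -> 0 < e ->
  exists2 k : R, 0 < k & forall t o d u v, 0 < t <= k -> 0 < d ->
    displacement_le x rho o d ->
    fixed (positive_part f) u -> fixed (positive_part (- f)) v ->
    `|u - v| <= C * d ->
    (forall u' v', fixed (positive_part f) u' -> fixed (positive_part (- f)) v' ->
       spread t o u v <= spread t o u' v' + k * d) ->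
    forall p, almost_fixed rho (x b p) u (e * d) /\
              almost_fixed rho (x b p) v (e * d).
Proof.
move=> fW fb C0 e0; have [M MP] := sg_core xP b.
(* With [ep = e / (2 M + 1)], the vectors [l u - u] and [l v - v] agree up to
   [ep * d], and [l u - u] is shown to have norm at most [2 M (ep * d)]. *)
pose M1 : R := (2 * M + 1)%:R.
have M10 : 0 < M1 by rewrite ltr0n addn1.
pose ep := e / M1; have ep0 : 0 < ep by rewrite divr_gt0.
have [th th0 thP] := close_of_long_midpoint ucV C0 ep0.
exists (th / 2) => [|t o d u v /andP[t0 tk] d0 od uP vP uvC uvmin].
  by rewrite divr_gt0.
have epd0 : 0 < ep * d by rewrite mulr_gt0.
have Nb : normalized_by (positive_part f) b by exact: wall_normalizes.
have Nb' : normalized_by (positive_part (- f)) b.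
  by apply: wall_normalizes; rewrite opp_lfunE fb oppr0.
(* [parallel]: by near minimality, the midpoints of [u], [l u] and of [v], [l v]
   are not much closer to each other than [u] and [v]. *)
pose w p := rho (x b p) u - u.
have parallel p : `|w p - (rho (x b p) v - v)| <= ep * d.
  set lu := rho (x b p) u; set lv := rho (x b p) v.
  have -> : w p - (lv - v) = - ((u - v) - (lu - lv)).
    by rewrite /w -/lu !opprB addrACA [RHS]addrACA [- u - lv]addrC.
  rewrite normrN; apply: thP => //; first exact: aia_isometric.
  have luP : fixed (positive_part f) lu by apply: (fixed_by_translate xP rhoP).
  have lvP : fixed (positive_part (- f)) lv by apply: (fixed_by_translate xP rhoP).
  have := uvmin _ _ (fixed_by_midpoint rhoP uP luP) (fixed_by_midpoint rhoP vP lvP).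
  rewrite /spread -scalerBr normrZ ger0_norm ?invr_ge0 //.
  have -> : u + lu - (v + lv) = (u - v) + (lu - lv) by rewrite opprD addrACA.
  have luo : `|2^-1 *: (u + lu) - o| <= `|u - o| + d / 2.
    have -> : 2^-1 *: (u + lu) - o = 2^-1 *: ((u - o) + (lu - o)).
      rewrite addrACA -opprD -mulr2n -(scaler_nat 2 o) scalerBr.
      by rewrite scalerA mulVf ?scale1r.
    rewrite normrZ ger0_norm ?invr_ge0 //.
    have h1 := ler_normD (u - o) (lu - o).
    have h2 := ler_distD (rho (x b p) o) lu o.
    rewrite (aia_isometric rhoP) in h2.
    have h3 := od b p; rewrite /almost_fixed in h3.
    lra.
  have : t * `|2^-1 *: (u + lu) - o| <= t * `|u - o| + th / 2 * (d / 2).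
    have := ler_wpM2l (ltW t0) luo.
    have : t * (d / 2) <= th / 2 * (d / 2) by apply: ler_wpM2r; lra.
    lra.
  have : 0 < th * d by rewrite mulr_gt0.
  lra.
have inv c q p : val c != val b -> val c != - val b ->
    `|lin (x c q) (w p) - w p| <= 2 * (ep * d).
  move=> cb cNb.
  have [fc|fc|fc] := ltgtP (f (val c) : R) 0; last first.
  - by have [/eqP|/eqP] := fW _ _ fb fc; rewrite ?(negPf cb) ?(negPf cNb).
  - have luP : fixed (positive_part f) (rho (x b p) u).
      by apply: (fixed_by_translate xP rhoP).
    rewrite /w linear_partB // (luP c q) ?(uP c q) // subrr normr0; lra.
  have lvP : fixed (positive_part (- f)) (rho (x b p) v).
    by apply: (fixed_by_translate xP rhoP).
  have fc' : positive_part (- f) c by rewrite /positive_part opp_lfunE oppr_gt0.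
  set z := rho (x b p) v - v.
  have zfix : lin (x c q) z = z by rewrite /z linear_partB // (lvP c q) ?(vP c q).
  have h1 := ler_distD z (lin (x c q) (w p)) (w p).
  have h2 : `|lin (x c q) (w p) - z| <= ep * d.
    rewrite -{1}zfix /linear_part opprB addrA subrK (aia_isometric rhoP).
    exact: parallel.
  have := parallel p; rewrite -/z distrC => h3.
  lra.
have twice p q : `|lin (x b p) (w q) - w q| <= 2 * (ep * d) * M%:R.
  have [s [sM -> sP]] := MP p.
  apply: le_trans (linear_part_word _) _.
    by move=> c /sP[cb cNb]; apply: inv.
  rewrite -[leLHS]mulr_natr; apply: ler_wpM2l; last by rewrite ler_nat.
  by lra.
pose W : set R := [set r | exists p, r = `|w p|]%classic.
have Wub : has_sup W.
  split; first by exists `|w 0|, 0.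
  exists (d + 2 * `|o - u|) => _ [p ->].
  exact: (almost_fixed_near rhoP (od b p)).
have wsup p : `|w p| <= sup W by apply: ub_le_sup; [case: Wub|exists p].
have wsmall p : `|w p| <= 2 * (ep * d) * M%:R.
  apply: le_trans (wsup p) _.
  suff : sup W <= (sup W + 2 * (ep * d) * M%:R) / 2 by lra.
  apply: ge_sup; first by case: Wub.
  move=> _ [q ->]; rewrite ler_pdivlMr //.
  have e2 : w q *+ 2 = w (q + q) - (lin (x b q) (w q) - w q).
    have -> : w (q + q) = rho (x b q) (rho (x b q) u) - u.
      by rewrite /w (sg_add xP) (aia_mul rhoP).
    rewrite linear_partB // !opprB addrCA mulr2n; congr (_ + _).
    by rewrite [RHS]addrC addrA subrK.
  rewrite [leLHS]mulr_natr -normrMn e2; apply: le_trans (ler_normB _ _) _.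
  by rewrite lerD.
have M1E : e * d = 2 * (ep * d) * M%:R + ep * d.
  have e1 : e = ep * M1 by rewrite /ep divfK ?gt_eqF.
  by rewrite e1 /M1 natrD natrM; ring.
move=> p; split; rewrite /almost_fixed M1E.
  by have := wsmall p; lra.
have h := ler_distD (w p) (rho (x b p) v - v) 0.
rewrite !subr0 in h; have := parallel p; have := wsmall p.
by rewrite distrC in h; lra.
Qed.
End Contraction.

Section FixedPoint.
Variables (R : realType) (E : vectType R) (Phi : {fset E}) (A : zmodType).
Variables (G : groupType) (x : Phi -> A -> G).
Hypothesis xP : strongly_graded x.
Variables (V : completeNormedModType R) (rho : G -> V -> V).
Hypothesis ucV : uniformly_convex V.
Hypothesis rhoP : affine_isometric_action rho.

Local Notation fixed := (fixed_by x rho).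

(** Passing to the next wall: the unipotent group of [g] is contained in the
    group generated by that of [f] and by one root subgroup of the
    wall [f = 0]. *)
Lemma cross_wall (f g : 'Hom(E, R^o)) (s : R) (u : V) :
  wall_functional Phi f ->
  (forall c : Phi, (0 : R) <= f (val c) * g (val c)) -> 0 <= s ->
  fixed (positive_part f) u ->
  (forall (c : Phi) p, f (val c) = 0 -> almost_fixed rho (x c p) u s) ->
  exists2 u', fixed (positive_part g) u' & `|u' - u| <= s.
Proof.
move=> fW fg s0 uP ufix.
have fpos (c : Phi) : positive_part g c -> f (val c) != 0 -> positive_part f c.
  rewrite /positive_part => gc fc; have := fg c.
  by rewrite pmulr_lge0 // lt_neqAle eq_sym fc.
have [c /andP[/eqP fc gc]|none] :=
    pickP [pred c : Phi | (f (val c) == 0) && (positive_part g c)].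
  have Nc := wall_normalizes fc.
  have [u' [u'P cu' u'u]] := fixed_by_extend xP ucV rhoP Nc uP (ufix c ^~ fc).
  exists u' => // b p gb; have [fb|fb] := eqVneq (f (val b)) 0; last first.
    by apply: u'P; exact: fpos.
  have [/val_inj -> //|bc] := fW c b fc fb.
  move: gc gb; rewrite /positive_part bc linearN /= oppr_gt0.
  by move=> /lt_trans gc /gc; rewrite ltxx.
exists u; last by rewrite subrr normr0.
move=> b p gb; apply: uP; apply: fpos => //.
by have := none b; rewrite /= gb andbT => ->.
Qed.

Variable f : Phi -> 'Hom(E, R^o).
Hypothesis fP : forall a b : Phi,
  f a (val b) = 0 <-> val b = val a \/ val b = - val a.
Hypothesis fC : forall a b : Phi,
  connect (fun a b => [forall c : Phi, 0 <= f a (val c) * f b (val c)]) a b.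

Lemma wall_functional_root a : wall_functional Phi (f a).
Proof.
move=> b c /fP[] -> /fP[] ->; rewrite ?opprK; by [left | right].
Qed.

Lemma wall_functional_opp g : wall_functional Phi g -> wall_functional Phi (- g).
Proof.
move=> gW b c; rewrite !opp_lfunE => /eqP + /eqP; rewrite !oppr_eq0.
by move=> /eqP + /eqP; exact: gW.
Qed.

Definition opposite_pair (a : Phi) (u v : V) :=
  fixed (positive_part (f a)) u /\ fixed (positive_part (- f a)) v.

Definition nearly_minimal (t : R) (o : V) (D k : R) (a : Phi) (u v : V) :=
  opposite_pair a u v /\ spread t o u v <= D + k.

(** The bound [D] is common to all walls.  This is what allows a pair to be
    carried from one wall to the next: a pair that almost reaches [D] is almost
    minimal at the wall where it lives. *)
Definition minimization_data (C k t : R) (o : V) (d D : R) :=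
  [/\ 0 < t <= k, 0 < d, displacement_le x rho o d, D <= C * d &
      forall a u v, opposite_pair a u v -> D <= spread t o u v].

Lemma minimization_data_le C k l t o d D : k <= l ->
  minimization_data C k t o d D -> minimization_data C l t o d D.
Proof. by move=> kl [/andP[t0 tk] *]; split=> //; rewrite t0 (le_trans tk). Qed.

Lemma nearly_minimal_le t o D k l a u v : k <= l ->
  nearly_minimal t o D k a u v -> nearly_minimal t o D l a u v.
Proof. by move=> kl [ap h]; split=> //; apply: le_trans h _; rewrite lerD2l. Qed.

(** Being almost fixed by the root subgroups of its wall, a nearly minimal pair
    can be moved slightly to become fixed by the opposite unipotent groups of a
    neighbouring wall, and there it is nearly minimal again. *)
Lemma nearly_minimal_step C e a b : 0 < C -> 0 < e ->
  (forall c : Phi, (0 : R) <= f a (val c) * f b (val c)) ->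
  exists2 k : R, 0 < k & forall t o d D u v, minimization_data C k t o d D ->
    nearly_minimal t o D (k * d) a u v ->
    (forall (c : Phi) p, f a (val c) = 0 -> almost_fixed rho (x c p) u (e * d)) /\
    exists u' v', nearly_minimal t o D (e * d) b u' v' /\ `|u' - u| <= e * d.
Proof.
move=> C0 e0 ab; have e40 : 0 < e / 4 by rewrite divr_gt0.
have C10 : 0 < C + 1 by lra.
have [k1 k10 k1P] : exists2 k : R, 0 < k & forall c : Phi, f a (val c) = 0 ->
    forall t o d D u v, minimization_data C k t o d D ->
    nearly_minimal t o D (k * d) a u v ->
    forall p, almost_fixed rho (x c p) u (e / 4 * d) /\
              almost_fixed rho (x c p) v (e / 4 * d).
  apply: uniform_positive => [c k l H /andP[l0 lk] fc t o d D u v md nm|c].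
    have d0 : 0 < d by case: md.
    apply: H (minimization_data_le lk md) (nearly_minimal_le _ nm) => //.
    by rewrite ler_pM2r.
  have [fc|fc] := eqVneq (f a (val c)) 0; last first.
    by exists 1 => // /eqP; rewrite (negPf fc).
  have [k k0 kP] :=
    wall_almost_fixed xP ucV rhoP (@wall_functional_root a) fc C10 e40.
  exists (Num.min k 1) => [|_ t o d D u v [/andP[t0 tk] d0 od DC Dmin]].
    by rewrite lt_min k0 ltr01.
  move: tk; rewrite le_min => /andP[tk t1] [[uP vP] uv].
  have kd : Num.min k 1 * d <= k * d by rewrite ler_pM2r // ge_min lexx.
  have k1d : Num.min k 1 * d <= 1 * d by rewrite ler_pM2r // ge_min lexx orbT.
  apply: (kP t o d u v) => //; first by rewrite t0.
    have : 0 <= t * `|u - o| by rewrite mulr_ge0 // ltW.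
    by move: uv; rewrite /spread; lra.
  move=> u' v' u'P v'P; apply: le_trans uv _; apply: lerD => //.
  by apply: (Dmin a); split.
(* Both components move by at most [e / 4 * d], which raises the spread by at
   most [(2 + t) * (e / 4) * d] with [t <= 1]. *)
exists (Num.min k1 (Num.min 1 (e / 4))).
  by rewrite !lt_min k10 ltr01 e40.
set k := Num.min _ _.
have kk1 : k <= k1 by rewrite ge_min lexx.
have kone : k <= 1 by rewrite !ge_min lexx orbT.
have ke : k <= e / 4 by rewrite !ge_min lexx !orbT.
move=> t o d D u v md nm.
have [/andP[t0 tk] d0 od DC Dmin] := md; have [[uP vP] uv] := nm.
have ed0 : 0 < e * d by rewrite mulr_gt0.
have fix1 (c : Phi) p : f a (val c) = 0 ->
    almost_fixed rho (x c p) u (e / 4 * d) /\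
    almost_fixed rho (x c p) v (e / 4 * d).
  move=> fc.
  apply: k1P (minimization_data_le kk1 md) (nearly_minimal_le _ nm) _ => //.
  by rewrite ler_pM2r.
split=> [c p fc|].
  have [h _] := fix1 c p fc; apply: le_trans h _; lra.
have s0 : 0 <= e / 4 * d by lra.
have [u' u'P u'u] := cross_wall (@wall_functional_root a) ab s0 uP
  (fun c p fc => proj1 (fix1 c p fc)).
have fcO (c : Phi) : (- f a) (val c) = 0 -> f a (val c) = 0.
  by rewrite opp_lfunE => /eqP; rewrite oppr_eq0 => /eqP.
have abO (c : Phi) : (0 : R) <= (- f a) (val c) * (- f b) (val c).
  by rewrite !opp_lfunE mulrNN.
have [v' v'P v'v] := cross_wall (wall_functional_opp (@wall_functional_root a))
  abO s0 vP (fun c p fc => proj2 (fix1 c p (fcO c fc))).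
exists u', v'; split; last by apply: le_trans u'u _; lra.
split; first by split.
have h1 := ler_distD u u' v'; have h2 := ler_distD v u v'.
have h3 := ler_distD u u' o.
have h4 := ler_wpM2l (ltW t0) h3.
have h5 : t * `|u' - u| <= 1 * `|u' - u|.
  by apply: ler_wpM2r => //; exact: le_trans kone.
have kd : k * d <= e / 4 * d by rewrite ler_pM2r.
rewrite distrC in v'v.
move: uv; rewrite /spread; lra.
Qed.

Lemma nearly_minimal_path C a b : 0 < C -> forall e, 0 < e ->
  exists2 k : R, 0 < k & forall t o d D u v, minimization_data C k t o d D ->
    nearly_minimal t o D (k * d) a u v ->
    exists u' v', nearly_minimal t o D (e * d) b u' v' /\ `|u' - u| <= e * d.
Proof.
move=> C0; have /connectP[p pP ->] := fC a b.
elim: p a pP => [|c p IH] a /=.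
  move=> _ e e0; exists e => // t o d D u v md nm; exists u, v; split=> //.
  by rewrite subrr normr0 mulr_ge0 // ltW //; case: md.
move=> /andP[/forallP ac pP] e e0.
have [k2 k20 k2P] := IH c pP (e / 2) (divr_gt0 e0 (ltr0n _ 2)).
have m0 : 0 < Num.min k2 (e / 2) by rewrite lt_min k20 divr_gt0.
have [k1 k10 k1P] := nearly_minimal_step C0 m0 ac.
exists (Num.min k1 k2) => [|t o d D u v md nm]; first by rewrite lt_min k10.
have d0 : 0 < d by case: md.
have [||_ [u1 [v1 [nm1 u1u]]]] :=
    k1P t o d D u v (minimization_data_le _ md) (nearly_minimal_le _ nm).
- by rewrite ge_min lexx.
- by rewrite ler_pM2r // ge_min lexx.
have [||u2 [v2 [nm2 u2u1]]] :=
    k2P t o d D u1 v1 (minimization_data_le _ md) (nearly_minimal_le _ nm1).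
- by rewrite ge_min lexx orbT.
- by rewrite ler_pM2r // ge_min lexx.
have md2 : Num.min k2 (e / 2) * d <= e / 2 * d.
  by rewrite ler_pM2r // ge_min lexx orbT.
have ed0 : 0 < e * d by rewrite mulr_gt0.
exists u2, v2; split; first by apply: nearly_minimal_le nm2; lra.
have := ler_distD u1 u2 u; lra.
Qed.

(** Follow a chain of walls to the wall of any given root: the pair moves little
    on the way, and at the end it is almost fixed by the root subgroup. *)
Lemma nearly_minimal_almost_fixed C e : 0 < C -> 0 < e ->
  exists2 k : R, 0 < k & forall a t o d D u v, minimization_data C k t o d D ->
    nearly_minimal t o D (k * d) a u v -> displacement_le x rho u (e * d).
Proof.
move=> C0 e0.
suff [k k0 kP] : exists2 k : R, 0 < k & forall ab : Phi * Phi,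
    forall t o d D u v, minimization_data C k t o d D ->
    nearly_minimal t o D (k * d) ab.1 u v ->
    forall p, almost_fixed rho (x ab.2 p) u (e * d).
  by exists k => // a t o d D u v md nm b p; exact: (kP (a, b)) nm p.
apply: uniform_positive => [ab k l H /andP[l0 lk] t o d D u v md nm|[a b] /=].
  have d0 : 0 < d by case: md.
  apply: H (minimization_data_le lk md) (nearly_minimal_le _ nm).
  by rewrite ler_pM2r.
have e40 : 0 < e / 4 by rewrite divr_gt0.
have bb (c : Phi) : (0 : R) <= f b (val c) * f b (val c).
  by rewrite -expr2 sqr_ge0.
have [k1 k10 k1P] := nearly_minimal_step C0 e40 bb.
have m0 : 0 < Num.min k1 (e / 4) by rewrite lt_min k10.
have [k2 k20 k2P] := nearly_minimal_path a b C0 m0.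
exists (Num.min k1 k2) => [|t o d D u v md nm p]; first by rewrite lt_min k10.
have d0 : 0 < d by case: md.
have [||u1 [v1 [nm1 u1u]]] :=
    k2P t o d D u v (minimization_data_le _ md) (nearly_minimal_le _ nm).
- by rewrite ge_min lexx orbT.
- by rewrite ler_pM2r // ge_min lexx orbT.
have [||bfix _] :=
    k1P t o d D u1 v1 (minimization_data_le _ md) (nearly_minimal_le _ nm1).
- by rewrite ge_min lexx.
- by rewrite ler_pM2r // ge_min lexx.
have fbb : f b (val b) = 0 by apply/fP; left.
have md2 : Num.min k1 (e / 4) * d <= e / 4 * d.
  by rewrite ler_pM2r // ge_min lexx orbT.
have ed0 : 0 < e * d by rewrite mulr_gt0.
apply: le_trans (almost_fixed_near rhoP (bfix b p fbb) u1u) _; lra.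
Qed.

(** Every point is followed, at a distance controlled by its displacement, by a
    point of half the displacement: the first component of a pair that almost
    minimizes the spread over all walls. *)
Lemma displacement_halving (a0 : Phi) : exists2 C : R, 0 <= C &
  forall o d, 0 < d -> displacement_le x rho o d ->
    exists2 u, displacement_le x rho u (d / 2) & `|u - o| <= C * d.
Proof.
have [C1 C10 C1P] := fixed_by_positive xP ucV rhoP (f a0).
have [C2 C20 C2P] := fixed_by_positive xP ucV rhoP (- f a0).
(* The spread of an initial pair is at most [(C1 + C2) d + t (C1 d)]. *)
pose C := 2 * C1 + C2 + 1; have C0 : 0 < C by rewrite /C; lra.
have half : (0 : R) < 2^-1 by rewrite invr_gt0.
have [k k0 kP] := nearly_minimal_almost_fixed C0 half.
pose t := Num.min k 1; have t0 : 0 < t by rewrite lt_min k0 ltr01.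
exists ((C + k) / t) => [|o d d0 od].
  by rewrite divr_ge0 ?ltW // addr_gt0.
have [u0 u0P u0o] := C1P o d od; have [v0 v0P v0o] := C2P o d od.
pose S : set R := [set s | exists a u v, opposite_pair a u v /\ s = spread t o u v].
have S0 : lbound S 0.
  by move=> _ [a [u [v [_ ->]]]]; rewrite addr_ge0 // mulr_ge0 // ltW.
have Sin : S (spread t o u0 v0) by exists a0, u0, v0.
have Sinf : has_inf S by split; [exists (spread t o u0 v0) | exists 0].
have Smin a u v : opposite_pair a u v -> inf S <= spread t o u v.
  by move=> uv; apply: ge_inf; [exists 0 | exists a, u, v].
have SC : inf S <= C * d.
  apply: le_trans (ge_inf _ Sin) _; first by exists 0.
  have t1 : t * `|u0 - o| <= 1 * `|u0 - o|.
    by apply: ler_wpM2r => //; rewrite ge_min lexx orbT.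
  have h := ler_distD o u0 v0; rewrite (distrC o) in h.
  by rewrite /spread /C; lra.
have [s [a [u [v [uv ->]]]] us] := inf_adherent (mulr_gt0 k0 d0) Sinf.
have md : minimization_data C k t o d (inf S).
  by split=> //; rewrite t0 ge_min lexx.
exists u; first by have := kP a t o d _ u v md (conj uv (ltW us)); rewrite mulrC.
rewrite mulrAC ler_pdivlMr // mulrC mulrDl.
apply: le_trans (le_trans (ltW us) (lerD SC (lexx _))).
by rewrite /spread lerDr.
Qed.

Lemma displacement_fixed v : displacement_le x rho v 0 -> forall g, rho g v = v.
Proof.
move=> vP g; have [w ->] := sg_gen xP g.
apply: (@fixed_by_word _ _ _ _ _ _ _ _ rhoP predT); last exact/allP.
by move=> a p _; apply/eqP; rewrite -subr_eq0 -normr_le0; exact: vP.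
Qed.

(** Iterating the halving of the displacement gives a sequence with geometrically
    decreasing steps, whose limit is fixed. *)
Lemma global_fixed_point (a0 : Phi) o d : displacement_le x rho o d ->
  exists v, forall g, rho g v = v.
Proof.
wlog d0 : d / 0 < d.
  move=> H od; apply: (H (`|d| + 1)); first by rewrite ltr_wpDl.
  move=> a p; apply: le_trans (od a p) _.
  by apply: le_trans (ler_norm _) _; rewrite lerDl.
move=> od; have [C C0 CP] := displacement_halving a0.
pose small n u := displacement_le x rho u (d / 2 ^+ n).
have d2 n : 0 < d / 2 ^+ n by rewrite divr_gt0 // exprn_gt0.
have next n u : exists u', small n u ->
    small n.+1 u' /\ `|u' - u| <= C * (d / 2 ^+ n).
  have [us|us] := pselect (small n u); last by exists u.
  have [u' h1 h2] := CP u _ (d2 n) us; exists u' => _; split=> //.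
  by rewrite /small exprSr invfM mulrA.
have /choice[nx nxP] (nu : nat * V) := next nu.1 nu.2.
pose z := fix z n := if n is m.+1 then nx (m, z m) else o.
have zs n : small n (z n).
  elim: n => [|n IH]; first by rewrite /small expr0 divr1.
  by case: (nxP (n, z n) IH).
have zz n : `|z n.+1 - z n| <= C * (d / 2 ^+ n) by case: (nxP (n, z n) (zs n)).
have zC m n : `|z (m + n)%N - z m| <=
    2 * C * (d / 2 ^+ m) - 2 * C * (d / 2 ^+ (m + n)).
  elim: n => [|n IH]; first by rewrite addn0 !subrr normr0.
  move: IH; have := ler_distD (z (m + n)%N) (z (m + n.+1)%N) (z m).
  have := zz (m + n)%N; rewrite -addnS.
  have -> : d / 2 ^+ (m + n) = 2 * (d / 2 ^+ (m + n.+1)).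
    by rewrite addnS exprS invfM; field; rewrite expf_neq0.
  lra.
have small_tail (e : R) : 0 < e ->
    exists N, forall n, (N <= n)%N -> d / 2 ^+ n <= e.
  move=> e0; exists (Num.bound (d / e)) => n Nn.
  rewrite ler_pdivrMr ?exprn_gt0 // mulrC -ler_pdivrMr //.
  apply: le_trans (ltW (archi_boundP _)) _; first by rewrite divr_ge0 ?ltW.
  rewrite -natrX ler_nat; apply: leq_trans Nn _; exact/ltnW/ltn_expl.
have C20 : 0 < 4 * C + 1 by lra.
have [l lP] : exists l, forall e : R, 0 < e -> exists N, forall n, (N <= n)%N ->
     `|l - z n| <= e.
  apply: cauchy_limit => e e0.
  have [N NP] := small_tail (e / (4 * C + 1)) (divr_gt0 e0 C20).
  exists N => m n Nm Nn.
  have tail j : (N <= j)%N -> `|z j - z N| <= e / 2.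
    move=> /subnKC <-; apply: le_trans (zC _ _) _.
    have := NP N (leqnn _); rewrite ler_pdivlMr // => h.
    have : 0 <= C * (d / 2 ^+ (N + (j - N))) by rewrite mulr_ge0 // ltW.
    have := d2 N; lra.
  have := ler_distD (z N) (z m) (z n).
  have := tail m Nm; have := tail n Nn; rewrite [X in X <= _]distrC; lra.
exists l; apply: displacement_fixed => a p; apply/ler_addgt0Pr => e e0.
have e40 : 0 < e / 4 by rewrite divr_gt0.
have [N1 N1P] := lP _ e40; have [N2 N2P] := small_tail _ e40.
pose n := maxn N1 N2.
have h1 := N1P n (leq_maxl _ _); have h2 := N2P n (leq_maxr _ _).
rewrite distrC in h1; apply: le_trans (almost_fixed_near rhoP (zs n a p) h1) _.
lra.
Qed.

End FixedPoint.

(** * Root strings *)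

Section InnerProduct.
Variables (R : realType) (E : vectType R) (ip : {dot E for idfun}).

Lemma ipC u v : ip u v = ip v u.
Proof. by rewrite hermC /= expr0 mul1r. Qed.

Lemma ipDl u v w : ip (u + v) w = ip u w + ip v w.
Proof. by rewrite linearDl. Qed.

Lemma ipZl r u w : ip (r *: u) w = r * ip u w.
Proof. by rewrite linearZl_LR. Qed.

Lemma ipNl u w : ip (- u) w = - ip u w.
Proof. by rewrite linearNl. Qed.

Lemma ipMnl u w n : ip (u *+ n) w = ip u w *+ n.
Proof. by rewrite linearMnl. Qed.

Lemma ip_gt0 u : u != 0 -> 0 < ip u u.
Proof. exact: neq0_dnorm_gt0. Qed.

(** The inequality is strict because [u] differs from its projection to the line
    of [v]. *)
Lemma ip_cauchy_schwarz u v : v != 0 -> (forall r, u <> r *: v) ->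
  ip u v * ip u v < ip u u * ip v v.
Proof.
move=> v0 uv; have vv := ip_gt0 v0.
have : 0 < ip (u - (ip u v / ip v v) *: v) (u - (ip u v / ip v v) *: v).
  by apply: ip_gt0; rewrite subr_eq0; apply/eqP; exact: uv.
set r := ip u v / ip v v.
rewrite -scaleNr ipDl ipZl (ipC u (_ + _)) (ipC v (_ + _)) !ipDl !ipZl (ipC v u).
have e : ip u v = r * ip v v by rewrite /r divfK ?gt_eqF.
move=> /(mulr_gt0 vv) h.
have -> : ip u v * ip u v = r * ip u v * ip v v by rewrite {1}e mulrAC.
rewrite e in h *; lra.
Qed.

End InnerProduct.

Section RootStrings.
Variables (R : realType) (E : vectType R) (Phi : {fset E}).
Variable ip : {dot E for idfun}.
Hypothesis hPhi : root_system Phi.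
Hypothesis hred : reduced Phi.
Hypothesis ipP : crystallographic_for Phi ip.

Lemma roots_no0 : 0 \notin Phi. Proof. by case: hPhi. Qed.

Lemma roots_opp v : (- v \in Phi) = (v \in Phi).
Proof. by case: hPhi => _ _ _ /(_ v) ->. Qed.

Lemma one_root_per_line : one_per_line Phi.
Proof.
move=> a b r bE; have a0 := root_neq0 roots_no0 a.
have aNa : val a != - val a.
  rewrite -addr_eq0 -mulr2n -scaler_nat scaler_eq0 pnatr_eq0 /=.
  exact: a0.
have [//|ba] := eqVneq (val b) (val a); first by left.
have [//|bNa] := eqVneq (val b) (- val a); first by right.
have := @hred <[val a]>%VS; rewrite dim_vline a0 => /(_ erefl).
rewrite leqNgt => /negP[].
apply: (@uniq_leq_size _ [:: val a; - val a; val b]).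
  by rewrite /= !inE negb_or aNa [val a == _]eq_sym ba [- _ == _]eq_sym bNa.
move=> c cs; suff [cP ca] : c \in Phi /\ c \in <[val a]>%VS.
  by rewrite !inE /= ca andbT.
move: cs; rewrite !inE => /or3P[]/eqP->; rewrite ?roots_opp ?memvN; split.
all: rewrite ?bE; by [exact: valP | rewrite ?memvZ ?memv_line // -bE; exact: valP].
Qed.

(** The product of the two Cartan numbers of [a] and [b] is less than 4, so that
    one of them is 1, and the corresponding reflection maps one root to the
    difference of the two, up to sign. *)
Lemma root_difference (a b : Phi) : val b != val a -> 0 < ip (val a) (val b) ->
  val a - val b \in Phi.
Proof.
move=> ba ab0.
have a0 := ip_gt0 ip (root_neq0 roots_no0 a).
have b0 := ip_gt0 ip (root_neq0 roots_no0 b).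
have ab : val b != - val a.
  apply: contraTneq ab0 => ->; rewrite ipC ipNl oppr_gt0 -leNgt; exact: ltW.
have cs : ip (val a) (val b) * ip (val a) (val b) <
    ip (val a) (val a) * ip (val b) (val b).
  apply: ip_cauchy_schwarz; first exact: (root_neq0 roots_no0).
  move=> r /one_root_per_line[] e; first by rewrite e eqxx in ba.
  by rewrite e opprK eqxx in ab.
have [/intrP[m mE] abP] := ipP (valP a) (valP b).
have [/intrP[n nE] baP] := ipP (valP b) (valP a).
have m0 : 0 < m by rewrite -(ltr0z R) -mE divr_gt0 // mulr_gt0.
have n0 : 0 < n by rewrite -(ltr0z R) -nE divr_gt0 // mulr_gt0 // ipC.
have mn : m * n < 4.
  rewrite -(ltr_int R) intrM -mE -nE /cartan_number (ipC ip (val b)).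
  rewrite mulrACA -invfM ltr_pdivrMr ?mulr_gt0 //; lra.
have [m1|n1] : m = 1 \/ n = 1 by nia.
  by move: abP; rewrite mE m1 scale1r.
by move: baP; rewrite nE n1 scale1r -roots_opp opprB.
Qed.

(** Root strings have no gaps: along the string, the inner product with [g]
    decreases by [ip g g] at each step, so that the difference lemma extends the
    string downwards from [a] as long as it is positive, and upwards from the
    origin [b] as long as it is negative. *)
Lemma root_string_origin (a g : Phi) : val g != val a -> val g != - val a ->
  0 < ip (val a) (val g) ->
  exists (b : Phi) (j : nat), [/\ (0 < j)%N, val a = val b + val g *+ j,
    forall k, (k <= j)%N -> val b + val g *+ k \in Phi &
    forall k, (0 < k)%N -> val b - val g *+ k \notin Phi].
Proof.
move=> ga gNa ag0; have gg := ip_gt0 ip (root_neq0 roots_no0 g).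
pose P (d : Phi) := `[< exists m, val d = val a - val g *+ m >].
have Pa : P a by apply/asboolP; exists 0; rewrite mulr0n subr0.
case: (arg_minP (fun d : Phi => ip (val d) (val g)) Pa) => b /asboolP[j bE] bmin.
have noprop (d : Phi) m : val d = val a - val g *+ m ->
    val g != val d /\ val g != - val d.
  move=> dE; have aE : val a = val d + val g *+ m by rewrite dE subrK.
  split; apply/eqP => gd.
    have [] := one_root_per_line (a := g) (b := a) (r := m.+1%:R).
    - by rewrite aE -gd scaler_nat mulrS.
    - by move=> e; rewrite e eqxx in ga.
    - by move=> e; rewrite e opprK eqxx in gNa.
  have dN : val d = - val g by rewrite gd opprK.
  have [] := one_root_per_line (a := g) (b := a) (r := m%:R - 1).
  - by rewrite aE dN scalerBl scaler_nat scale1r addrC.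
  - by move=> e; rewrite e eqxx in ga.
  - by move=> e; rewrite e opprK eqxx in gNa.
have ipm m : ip (val a - val g *+ m) (val g) =
    ip (val a) (val g) - m%:R * ip (val g) (val g).
  by rewrite ipDl ipNl ipMnl mulr_natl.
have up m : val a - val g *+ m \in Phi -> 0 < ip (val a - val g *+ m) (val g) ->
    val a - val g *+ m.+1 \in Phi.
  move=> dP; have [gd _] := noprop [` dP]%fset m erefl.
  move=> /(root_difference (a := [` dP]%fset) gd) /=.
  by rewrite -addrA -opprD -mulrSr.
have down m : val a - val g *+ m.+1 \in Phi ->
    ip (val a - val g *+ m.+1) (val g) < 0 -> val a - val g *+ m \in Phi.
  move=> dP; have [_ gd] := noprop [` dP]%fset m.+1 erefl => ip0.
  have gP : - val g \in Phi by rewrite roots_opp; exact: valP.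
  have e : val a - val g *+ m.+1 = val a - val g *+ m - val g.
    by rewrite mulrSr opprD addrA.
  have := root_difference (a := [` dP]%fset) (b := [` gP]%fset).
  rewrite /= opprK {3}e subrK; apply; first by rewrite eqr_oppLR.
  by rewrite ipC ipNl oppr_gt0 ipC.
have string k : (k <= j)%N -> val a - val g *+ k \in Phi.
  have [pos|neg] := ltP 0 (ip (val a) (val g) - (k%:R - 1) * ip (val g) (val g)).
    move=> _; elim: k pos => [|k IH] pos.
      by rewrite mulr0n subr0; exact: valP.
    have pos' : 0 < ip (val a - val g *+ k) (val g).
      by move: pos; rewrite ipm -natr1; lra.
    by apply: up => //; apply: IH; move: pos'; rewrite ipm; nra.
  move=> kj; have : val a - val g *+ j \in Phi by rewrite -bE; exact: valP.
  move: kj => /subnKC <-; elim: (j - k)%N => [|i IH]; first by rewrite addn0.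
  rewrite addnS => h; apply: IH; apply: down => //.
  rewrite ipm -addnS natrD -natr1; have : 0 <= i%:R * ip (val g) (val g).
    by rewrite mulr_ge0 // ltW.
  lra.
exists b, j; split.
- rewrite lt0n; apply/eqP => j0.
  have aP : val a - val g *+ 1 \in Phi.
    by apply: up; rewrite mulr0n subr0 //; exact: valP.
  have := bmin [` aP]%fset; rewrite bE j0 mulr0n subr0 => h.
  have /h /= : P [` aP]%fset by apply/asboolP; exists 1.
  by rewrite ipm; lra.
- by rewrite bE subrK.
- move=> k kj; rewrite bE -addrA [- _ + _]addrC -opprB -mulrnBr //.
  by apply: string; rewrite leq_subr.
- move=> k k0; apply/negP => dP.
  have := bmin [` dP]%fset; have /[swap]/[apply] /= : P [` dP]%fset.
    by apply/asboolP; exists (j + k)%N; rewrite /= bE mulrnDr opprD addrA.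
  have : 0 < k%:R * ip (val g) (val g) by rewrite mulr_gt0 ?ltr0n.
  by rewrite ipDl ipNl ipMnl mulr_natl; lra.
Qed.

(** Otherwise [a] and [- a] would form a component of the root system. *)
Lemma nonorthogonal_root : irreducible Phi -> (2 <= \dim (fullv : {vspace E}))%N ->
  forall a : Phi, exists g : Phi,
    [/\ val g != val a, val g != - val a & 0 < ip (val a) (val g)].
Proof.
move=> hirr hrank a.
have [g /and3P[ga gNa ag]|orth] := pickP [pred g : Phi |
    [&& val g != val a, val g != - val a & ip (val a) (val g) != 0]].
  have [ag0|ag0|ag0] := ltgtP 0 (ip (val a) (val g)).
  - by exists g.
  - have gP : - val g \in Phi by rewrite roots_opp; exact: valP.
    exists [` gP]%fset; split=> /=; last by rewrite ipC ipNl oppr_gt0 ipC.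
      by rewrite eqr_oppLR.
    by rewrite eqr_opp.
  - by rewrite ag0 eqxx in ag.
exfalso; apply: hirr.
pose P1 : {fset E} := [fset val a; - val a]%fset.
have P1s : (spanf P1 <= <[val a]>)%VS.
  apply/span_subvP => v; rewrite !inE => /orP[]/eqP->; first exact: memv_line.
  by rewrite memvN memv_line.
have P2s : (spanf (Phi `\` P1)%fset <= lker (linfun (ip (val a) : E -> R^o)))%VS.
  apply/span_subvP => v; rewrite !inE => /andP[+ vP].
  rewrite negb_or => /andP[va vNa].
  rewrite memv_ker lfunE /=; have := orth [` vP]%fset.
  by rewrite /= va vNa /= => /negbFE.
exists P1, (Phi `\` P1)%fset; split.
- by apply/fset0Pn; exists (val a); rewrite !inE eqxx.
- apply/negP => /eqP/fsetP P20.
  have : (spanf Phi <= <[val a]>)%VS.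
    apply: subv_trans P1s; apply/span_subvP => v vP; apply: memv_span.
    by have := P20 v; rewrite inE vP andbT in_fset0 => /negbFE.
  case: hPhi => _ -> _ _ /dimvS; rewrite dim_vline => h.
  by have := leq_trans hrank h; case: (val a != 0).
- by apply/fdisjointP => v v1; rewrite inE v1.
- have aP : val a \in Phi by exact: valP.
  apply/fsetP => v; rewrite !inE; case: eqP => [->|_] /=; first by rewrite aP.
  by case: eqP => [->|_] //=; rewrite roots_opp aP.
- apply/eqP; rewrite -subv0; apply/subvP => v; rewrite memv_cap memv0.
  move=> /andP[/(subvP P1s)/vlineP[r ->] /(subvP P2s)].
  rewrite memv_ker lfunE /= ipC ipZl mulf_eq0.
  rewrite [X in _ || X]gt_eqF ?orbF ?ip_gt0 ?(root_neq0 roots_no0) //.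
  by move=> /eqP ->; rewrite scale0r.
Qed.

End RootStrings.

(** * Commutator constants *)

Section NilpotentExp.
Variables (K : fieldType) (L : vectType K).

Lemma nilpotent_expE (f : 'End(L)) v :
  nilpotent_exp f v = \sum_(k < (\dim {:L}).+1) (k`!%:R)^-1 *: iter k f v.
Proof.
rewrite /nilpotent_exp sum_lfunE; apply: eq_bigr => k _.
rewrite scale_lfunE; congr (_ *: _); rewrite /lfun_power.
by elim: (nat_of_ord k) => [|n IH]; rewrite /= ?id_lfunE // comp_lfunE IH.
Qed.

Lemma iter_lfun0 (f : 'End(L)) n : iter n f 0 = 0.
Proof. by elim: n => //= n ->; rewrite linear0. Qed.

Lemma iter_lfun_sum (f : 'End(L)) n (I : Type) (r : seq I) (a : I -> K)
    (F : I -> L) :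
  iter n f (\sum_(i <- r) a i *: F i) = \sum_(i <- r) a i *: iter n f (F i).
Proof.
elim: n => //= n ->; rewrite linear_sum; apply: eq_bigr => i _.
by rewrite linearZ.
Qed.

(** If [exp f] kills [v] and [m] is the last exponent with [f^m v <> 0], then
    [f^m (exp f v) = f^m v], a contradiction. *)
Lemma nilpotent_exp_lker0 (f : 'End(L)) N : (forall v, iter N f v = 0) ->
  lker (nilpotent_exp f) == 0%VS.
Proof.
move=> fN; rewrite -subv0; apply/subvP => v; rewrite memv_ker memv0 => /eqP expv.
have ex : exists n, iter n f v == 0 by exists N; rewrite fN.
case: (ex_minnP ex) => -[|m] /eqP mv mmin; first by rewrite -[v]/(iter 0 f v) mv.
have : iter m f (nilpotent_exp f v) = 0 by rewrite expv iter_lfun0.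
rewrite nilpotent_expE iter_lfun_sum big_ord_recl /= big1 => [|i _]; last first.
  by rewrite -iterSr -iterD addnC iterD mv iter_lfun0 scaler0.
rewrite addr0 fact0 invr1 scale1r => /eqP mv'.
by have := mmin m mv'; rewrite ltnn.
Qed.

Lemma nilpotent_exp_stable (f : 'End(L)) (U W : {vspace L}) v : v \in U ->
  (forall u, u \in U -> f u \in W) -> (W <= U)%VS ->
  nilpotent_exp f v - v \in W.
Proof.
move=> vU fUW WU.
rewrite nilpotent_expE big_ord_recl /= fact0 invr1 scale1r addrC addKr.
apply: rpred_sum => i _; apply: rpredZ; apply: (fUW).
elim: (nat_of_ord _) => [//|k IH] /=; exact/(subvP WU)/fUW.
Qed.

Lemma nilpotent_exp_linear (f : 'End(L)) v : v != 0 -> f (f v) = 0 ->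
  nilpotent_exp f v = v + f v.
Proof.
move=> v0 ffv; rewrite nilpotent_expE.
have : (0 < \dim {:L})%N.
  rewrite lt0n dimv_eq0; apply: contraNneq v0 => L0.
  by rewrite -memv0 -L0 memvf.
case: (\dim {:L}) => // d _; rewrite !big_ord_recl /= big1 ?addr0 => [|i _].
  by rewrite fact0 invr1 !scale1r.
by rewrite -!iterS !iterSr ffv iter_lfun0 scaler0.
Qed.

(** The exponential series in divided powers: [q m] records the coordinate on
    the [m]-th vector of a string, scaled so that [f] acts on it as a
    derivation. *)
Lemma nilpotent_exp_string (f : 'End(L)) (U : {vspace L}) (j : nat)
    (q : nat -> L -> K) :
  (forall k : nat, k`!%:R != 0 :> K) ->
  (forall u, u \in U -> f u \in U) -> (j <= \dim {:L})%N ->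
  (forall m, (m <= j)%N -> scalar (q m)) ->
  (forall u, u \in U -> q 0%N (f u) = 0) ->
  (forall m u, (m < j)%N -> u \in U -> q m.+1 (f u) = m.+1%:R * q m u) ->
  forall m v, (m <= j)%N -> v \in U ->
    q m (nilpotent_exp f v) = \sum_(k < m.+1) 'C(m, k)%:R * q k v.
Proof.
move=> fact_neq0 fU jL qlin q0 qS.
have q_iter l m v : (m <= j)%N -> v \in U ->
    q m (iter l f v) = if (l <= m)%N then (m ^_ l)%:R * q (m - l)%N v else 0.
  elim: l m v => [|l IH] m v mj vU; first by rewrite ffactn0 mul1r subn0.
  have vlU : iter l f v \in U by elim: l {IH} => //= l; exact: fU.
  case: m mj => [|m] mj /=; first by rewrite q0.
  rewrite qS // IH // ?(ltnW mj) // ltnS; case: leqP => lm; last by rewrite mulr0.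
  by rewrite ffactSS natrM mulrA subSS.
move=> m v mj vU; pose qm : L -> K^o := q m.
have qmZD a u w : q m (a *: u + w) = a * q m u + q m w by exact: qlin.
rewrite nilpotent_expE.
have -> : q m (\sum_(k < (\dim {:L}).+1) (k`!%:R)^-1 *: iter k f v) =
    \sum_(k < (\dim {:L}).+1) (k`!%:R)^-1 * q m (iter k f v).
  have q00 : q m 0 = 0.
    by have := qmZD (-1) 0 0; rewrite scaler0 addr0 mulN1r addNr.
  elim/big_rec2: _ => // i a w _ <-; exact: qmZD.
transitivity (\sum_(k < m.+1) 'C(m, m - k)%:R * q (m - k)%N v).
  rewrite (big_ord_widen (\dim {:L}).+1
    (fun k => 'C(m, m - k)%:R * q (m - k)%N v)) ?ltnS ?(leq_trans mj) //.
  rewrite [RHS]big_mkcond /=; apply: eq_bigr => k _.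
  rewrite q_iter // ltnS; case: leqP => km; last by rewrite mulr0.
  by rewrite bin_sub // mulrA -bin_ffact natrM [_^-1 * _]mulrC mulfK.
rewrite (reindex_inj rev_ord_inj) /=; apply: eq_bigr => k _.
by rewrite subSS subKn // -ltnS.
Qed.

Lemma basis_coordinate (B : seq L) (u : L) : basis_of fullv B -> u \in B ->
  exists f : 'Hom(L, K^o), f u = 1 /\
    forall w, w \in B -> w != u -> f w = 0.
Proof.
move=> Bb uB; have Bf := basis_free Bb.
have ui : (index u B < size B)%N by rewrite index_mem.
exists (linfun (coord (in_tuple B) (Ordinal ui) : L -> K^o)).
have cE w (wi : (index w B < size B)%N) : w \in B ->
    linfun (coord (in_tuple B) (Ordinal ui) : L -> K^o) w =
    (index u B == index w B)%:R :> K.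
  move=> wB; rewrite lfunE /= -{1}(nth_index 0 wB) eq_sym.
  exact: (@coord_free K L _ (in_tuple B) (Ordinal wi) (Ordinal ui) Bf).
split=> [|w wB wu]; first by rewrite cE // eqxx.
rewrite cE ?index_mem //; case: eqP => // e.
by have := nth_index 0 uB; rewrite e nth_index // => /eqP; rewrite (negPf wu).
Qed.

(** The signs [(-1) ^+ m] satisfy the same triangular system, by the expansion of
    [(1 - 1) ^+ m]. *)
Lemma binomial_inversion (j : nat) (d : nat -> K) : d 0%N = 1 ->
  (forall m, (0 < m <= j)%N -> \sum_(k < m.+1) 'C(m, k)%:R * d k = 0) ->
  forall m, (m <= j)%N -> d m = (-1) ^+ m.
Proof.
move=> d0 dS m; have [n] := ubnP m; elim: n m => // n IH m.
rewrite ltnS => mn mj; case: (posnP m) => [->//|m0].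
have := dS m; rewrite m0 mj => /(_ isT).
have : \sum_(k < m.+1) 'C(m, k)%:R * (-1) ^+ k = 0 :> K.
  have : (1 - 1) ^+ m = 0 :> K by rewrite subrr expr0n gtn_eqF.
  rewrite exprDn => e; rewrite -[RHS]e; apply: eq_bigr => k _.
  by rewrite expr1n mul1r mulr_natl.
rewrite !big_ord_recr /= !binn !mul1r => e1.
rewrite (eq_bigr (fun k : 'I_m => 'C(m, k)%:R * (-1) ^+ k)) => [e2|].
  by apply: (addrI (\sum_(k < m) 'C(m, k)%:R * (-1) ^+ k)); rewrite e1 e2.
move=> k _; rewrite IH //; first exact: leq_trans (ltn_ord k) mn.
by apply: leq_trans mj; exact: ltnW.
Qed.

End NilpotentExp.

Section ChevalleyConstants.
Variables (R : realType) (E : vectType R) (Phi : {fset E}).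
Variable ip : {dot E for idfun}.
Hypothesis hPhi : root_system Phi.
Hypothesis hred : reduced Phi.
Hypothesis ipP : crystallographic_for Phi ip.
Local Open Scope complex_scope.
Local Notation C := (R[i]).
Variables (L : vectType C) (ad : 'Hom(L, 'End(L))) (H : {vspace L}).
Variables (wt : E -> 'Hom(subvs_of H, C^o)) (Delta : seq Phi) (h e : Phi -> L).
Hypothesis adP : lie_bracket ad.
Hypothesis cb : chevalley_basis ad wt Delta h e.

Local Notation y := (root_automorphism ad e).

Lemma bracketC u v : ad u v = - ad v u.
Proof.
have [ad0 _] := adP; apply/eqP; rewrite -addr_eq0; apply/eqP.
have := ad0 (u + v); rewrite (linearD ad u v) add_lfunE !linearD /= !ad0.
by rewrite add0r addr0 addrC.
Qed.

Lemma mem_root_vectors (a : Phi) :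
  e a \in map h Delta ++ map e (enum {: Phi}).
Proof. by rewrite mem_cat map_f ?orbT // mem_enum. Qed.

Lemma root_vector_neq0 a : e a != 0.
Proof.
have := free_not0 (basis_free (cb_basis cb)) (mem_root_vectors a).
by [].
Qed.

Lemma root_vector_inj : injective e.
Proof.
have := free_uniq (basis_free (cb_basis cb)); rewrite cat_uniq => /and3P[_ _ eu].
exact/injectiveP.
Qed.

Lemma root_coordinate (a : Phi) : exists f : 'Hom(L, C^o), forall b,
  f (e b) = (b == a)%:R.
Proof.
have [f [fa f0]] := basis_coordinate (cb_basis cb) (mem_root_vectors a).
exists f => b; have [->//|ba] := eqVneq b a.
by apply: f0 (mem_root_vectors b) _; rewrite (inj_eq root_vector_inj).
Qed.

(** The filtration of the Lie algebra by the values of the roots on [X]; the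
    coroots have degree zero. *)
Definition degree_filtration (X : E) (t : R) : {vspace L} :=
  span ([seq h a | a <- enum {: Phi} & t <= 0] ++
        [seq e b | b <- enum {: Phi} & t <= ip (val b) X]).

Lemma root_vector_filtration X t b : t <= ip (val b) X ->
  e b \in degree_filtration X t.
Proof.
move=> tb; apply: memv_span; rewrite mem_cat; apply/orP; right.
by apply: map_f; rewrite mem_filter tb mem_enum.
Qed.

Lemma coroot_filtration X t a : t <= 0 -> h a \in degree_filtration X t.
Proof.
move=> t0; apply: memv_span; rewrite mem_cat; apply/orP; left.
by apply: map_f; rewrite mem_filter t0 mem_enum.
Qed.

Lemma degree_filtration_ind X t (U : vectType C) (f : 'Hom(L, U)) (W : {vspace U}) :
  (forall a, t <= 0 -> f (h a) \in W) ->
  (forall b, t <= ip (val b) X -> f (e b) \in W) ->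
  forall v, v \in degree_filtration X t -> f v \in W.
Proof.
move=> fh fe v; suff /subvP sub : (degree_filtration X t <= f @^-1: W)%VS.
  by move=> /sub; rewrite -memv_preim.
apply/span_subvP => u; rewrite mem_cat -memv_preim => /orP[] /mapP[a].
  by rewrite mem_filter => /andP[t0 _] ->; exact: fh.
by rewrite mem_filter => /andP[ta _] ->; exact: fe.
Qed.

Lemma degree_filtration_le X t u : u <= t ->
  (degree_filtration X t <= degree_filtration X u)%VS.
Proof.
move=> ut; apply/subvP => v vt; rewrite -[v]id_lfunE.
apply: (degree_filtration_ind _ _ vt) => a ta; rewrite id_lfunE.
  by apply: coroot_filtration; exact: le_trans ta.
by apply: root_vector_filtration; exact: le_trans ta.
Qed.

Lemma bracket_filtration X t a v : v \in degree_filtration X t ->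
  ad (e a) v \in degree_filtration X (t + ip (val a) X).
Proof.
apply: degree_filtration_ind => b tb.
  rewrite bracketC (cb_he cb ipP) rpredN; apply: rpredZ.
  by apply: root_vector_filtration; rewrite gerDr.
have [ba|ba] := eqVneq (val b) (- val a).
  rewrite (cb_opp cb ba); apply: coroot_filtration.
  by move: tb; rewrite ba ipNl; lra.
have [abP|abP] := boolP (val a + val b \in Phi); last first.
  by rewrite (cb_zero cb ba abP) mem0v.
have [p [_ _ adE]] := cb_sum cb (g := [` abP]%fset) (erefl : _ = val a + val b).
have eP : e [` abP]%fset \in degree_filtration X (t + ip (val a) X).
  by apply: root_vector_filtration => /=; rewrite ipDl; lra.
by case: adE => ->; rewrite ?rpredN rpredZ.
Qed.

Lemma filtration_exp X t a s v : 0 <= ip (val a) X ->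
  v \in degree_filtration X t ->
  y a s v - v \in degree_filtration X (t + ip (val a) X).
Proof.
move=> a0 vt; apply: nilpotent_exp_stable vt _ _; last first.
  by apply: degree_filtration_le; rewrite lerDl.
by move=> u ut; rewrite scale_lfunE; apply: rpredZ; exact: bracket_filtration.
Qed.

Lemma filtration_exp_stable X t a s v : 0 <= ip (val a) X ->
  v \in degree_filtration X t -> y a s v \in degree_filtration X t.
Proof.
move=> a0 vt; rewrite -[y a s v](subrK v) rpredD //.
apply: (subvP (degree_filtration_le _ _)) (filtration_exp s a0 vt).
by rewrite lerDl.
Qed.

(** The operator [ad e_a] raises the degree with respect to [a] by [ip a a], and
    the degrees that occur are bounded. *)
Lemma root_bracket_nilpotent a s : exists N, forall v, iter N (s *: ad (e a)) v = 0.
Proof.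
pose X := val a; pose g := ip X X.
have g0 : 0 < g := ip_gt0 ip (root_neq0 (roots_no0 hPhi) a).
pose D : R := 1 + \sum_(b : Phi) `|ip (val b) X|.
have bD (b : Phi) : `|ip (val b) X| < D.
  rewrite /D (bigD1 b) //= addrCA ltrDl ltr_wpDr // sumr_ge0 //.
have D0 : 0 < D by apply: le_lt_trans (bD a).
have full v : v \in degree_filtration X (- D).
  suff -> : degree_filtration X (- D) = fullv by rewrite memvf.
  apply/eqP; rewrite eqEsubv subvf -(span_basis (cb_basis cb)).
  apply/span_subvP => u; rewrite mem_cat => /orP[] /mapP[b _ ->].
    by apply: coroot_filtration; rewrite oppr_le0 ltW.
  by apply: root_vector_filtration; have := bD b; rewrite ltr_norml => /andP[/ltW].
have up n v : iter n (s *: ad (e a)) v \in degree_filtration X (- D + n%:R * g).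
  elim: n => [|n IH]; first by rewrite mul0r addr0.
  rewrite /= scale_lfunE; apply: rpredZ.
  have -> : - D + n.+1%:R * g = - D + n%:R * g + ip (val a) X.
    by rewrite -natr1 mulrDl mul1r addrA.
  exact: bracket_filtration.
pose N := Num.bound (2 * D / g).
have ND : 2 * D < N%:R * g.
  by rewrite -ltr_pdivrMr // archi_boundP // divr_ge0 // ltW // mulr_gt0.
exists N => v; apply/eqP; rewrite -memv0 -[iter _ _ _]id_lfunE.
apply: (degree_filtration_ind _ _ (up N v)) => b tb; exfalso.
  by move: tb; lra.
by have := bD b; have := ler_norm (ip (val b) X); lra.
Qed.

Lemma root_automorphismK a s : cancel (y a s)^-1%VF (y a s).
Proof.
have [N fN] := root_bracket_nilpotent a s.
exact/lker0_lfunVK/(nilpotent_exp_lker0 fN).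
Qed.

(** The vector [z] is a multiple of the coroot of [a]. *)
Lemma weight_vector (a : Phi) : exists z : L, forall b,
  ad (e b) z = (ip (val b) (val a))%:C *: e b.
Proof.
have a0 := ip_gt0 ip (root_neq0 (roots_no0 hPhi) a).
exists (- ((ip (val a) (val a) / 2)%:C *: h a)) => b.
rewrite linearN /= linearZ /= bracketC (cb_he cb ipP) scalerN opprK scalerA.
rewrite -rmorphM /cartan_number /=; congr (_%:C *: _).
by field; rewrite gt_eqF.
Qed.

(** The inner product is nondegenerate on the plane of [b] and [g]; the vector
    [X] is dual to [b] in this plane, and [z] is the corresponding combination
    of the coroots. *)
Lemma dual_functional (b g : Phi) : val b != val g -> val b != - val g ->
  exists (X : E) (z : L), [/\ ip (val b) X = 1, ip (val g) X = 0 &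
    forall a, ad (e a) z = (ip (val a) X)%:C *: e a].
Proof.
move=> bg bNg; have g0 := ip_gt0 ip (root_neq0 (roots_no0 hPhi) g).
set B := val b; set G := val g.
have cs : ip B G * ip B G < ip B B * ip G G.
  apply: ip_cauchy_schwarz; first exact: (root_neq0 (roots_no0 hPhi) g).
  by move=> r /(one_root_per_line hPhi hred)[] bE; [case/eqP: bg|case/eqP: bNg].
pose d := ip B B * ip G G - ip B G * ip B G.
have d0 : d != 0 by rewrite gt_eqF // subr_gt0.
have [zb zbP] := weight_vector b; have [zg zgP] := weight_vector g.
pose p := ip G G * d^-1; pose q := - ip B G * d^-1.
exists (p *: B + q *: G), (p%:C *: zb + q%:C *: zg); split.
- rewrite ipC ipDl !ipZl (ipC ip G) -(mulfV d0) /p /q /d; ring.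
- rewrite ipC ipDl !ipZl /p /q; ring.
- move=> a; rewrite linearD !linearZ /= zbP zgP !scalerA -scalerDl.
  rewrite -!rmorphM -rmorphD /= (ipC ip (val a) (_ + _)) ipDl !ipZl.
  by rewrite (ipC ip B) (ipC ip G).
Qed.

End ChevalleyConstants.

Section StringConstants.
Variables (R : realType) (E : vectType R) (Phi : {fset E}).
Variable ip : {dot E for idfun}.
Hypothesis hPhi : root_system Phi.
Hypothesis hred : reduced Phi.
Hypothesis ipP : crystallographic_for Phi ip.
Local Open Scope complex_scope.
Local Notation C := (R[i]).
Variables (L : vectType C) (ad : 'Hom(L, 'End(L))) (H : {vspace L}).
Variables (wt : E -> 'Hom(subvs_of H, C^o)) (Delta : seq Phi) (h e : Phi -> L).
Hypothesis adP : lie_bracket ad.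
Hypothesis cb : chevalley_basis ad wt Delta h e.

Local Notation y := (root_automorphism ad e).
Local Notation filt X t := (degree_filtration ip h e X t).

Section WeightVector.
Variables (X : E) (z : L).
Hypothesis zX : forall a, ad (e a) z = (ip (val a) X)%:C *: e a.

Lemma exp_weight_vector a s : z != 0 ->
  y a s z = z + (s * (ip (val a) X)%:C) *: e a.
Proof.
move=> z0; have [ad0 _] := adP.
rewrite /root_automorphism nilpotent_exp_linear // !scale_lfunE zX scalerA //.
by rewrite linearZ /= ad0 !scaler0.
Qed.

(** Modulo degree at least two, root automorphisms of degree at least one act
    on [z] as commuting translations. *)
Lemma product_weight_vector (T : eqType) (s : seq T) (r : T -> Phi) (k : T -> C) :
  z != 0 -> (forall t, t \in s -> 1 <= ip (val (r t)) X) ->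
  (\big[(fun f g => (f \o g)%VF) / \1%VF]_(t <- s) y (r t) (k t)) z -
  (z + \sum_(t <- s) (k t * (ip (val (r t)) X)%:C) *: e (r t)) \in filt X 2.
Proof.
move=> z0; elim: s => [|t s IH] sP.
  by rewrite !big_nil id_lfunE addr0 subrr mem0v.
rewrite !big_cons comp_lfunE.
set P := (X in y (r t) (k t) X); set W := \sum_(i <- s) _ in IH *.
have {IH}IH : P - (z + W) \in filt X 2.
  by apply: IH => u us; apply: sP; rewrite inE us orbT.
have t1 : 1 <= ip (val (r t)) X by apply: sP; rewrite mem_head.
have t0 : 0 <= ip (val (r t)) X by lra.
have WF : W \in filt X 1.
  rewrite /W big_seq; apply: rpred_sum => u us; apply: rpredZ.
  by apply: root_vector_filtration; apply: sP; rewrite inE us orbT.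
have -> : P = (P - (z + W)) + z + W by rewrite -addrA subrK.
rewrite 2!linearD /= exp_weight_vector //.
set Pd := P - (z + W); set kt := k t * _.
have -> : y (r t) (k t) Pd + (z + kt *: e (r t)) + y (r t) (k t) W -
    (z + (kt *: e (r t) + W)) =
    y (r t) (k t) Pd + (y (r t) (k t) W - W).
  rewrite [z + (_ + _)]addrA; set u := z + kt *: _; set v := y _ _ Pd.
  by rewrite opprD [LHS]addrA [v + u + _]addrAC addrK addrA.
apply: rpredD; first exact: (filtration_exp_stable ipP adP cb).
apply: (subvP (degree_filtration_le _ _ _ _ _)) (filtration_exp ipP adP cb _ t0 WF).
lra.
Qed.

End WeightVector.

(** If [b] is the origin of its root string in the direction of [g], then
    [c b g 1 j] is a sign.  Write the commutator formula as
    [y_b y_g = y_g y_b P] and apply it to a vector [z] of degree zero with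
    [ad e_g z = 0] and [ad e_b z = e_b]: in degree one, it says that
    [exp (ad e_g)] maps [e_b + sum_k c_(1k) e_(b + k g)] to [e_b].  So the
    [c_(1k)] are the coefficients of [exp (- ad e_g) e_b], which are signs. *)
Lemma string_constant (c : Phi -> Phi -> nat -> nat -> int) (b g : Phi)
    (j : nat) s :
  commutator_formula ad e c ->
  val b != val g -> val b != - val g -> (0 < j)%N ->
  (forall k, (k <= j)%N -> val b + val g *+ k \in Phi) ->
  (forall k, (0 < k)%N -> val b - val g *+ k \notin Phi) ->
  root_combinations b g s -> c b g 1%N j = 1 \/ c b g 1%N j = -1.
Proof.
move=> cF bg bNg j0 string origin sP; have [suniq smem _] := sP.
have [X [z [bX gX zX]]] := dual_functional hPhi hred ipP adP cb bg bNg.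
have z0 : z != 0.
  apply: contraTneq (root_vector_neq0 cb b) => z0; rewrite negbK.
  by have := zX b; rewrite bX z0 linear0 scale1r => <-.
pose r k : Phi := insubd b (val b + val g *+ k).
have rE k : (k <= j)%N -> val (r k) = val b + val g *+ k.
  by move=> kj; rewrite val_insubd string.
have r0 : r 0%N = b by apply: val_inj; rewrite rE // mulr0n addr0.
pose t0 := (1%N, j, r j).
have t0s : t0 \in s by rewrite smem j0 /= rE // mulr1n.
have degS t : t \in s -> ip (val t.2) X = t.1.1%:R.
  case: t => [[i k] a]; rewrite smem => /and3P[_ _ /eqP ->] /=.
  by rewrite ipDl !ipMnl bX gX mul0rn addr0.
have inj t : t \in s -> val t.2 = val (r j) -> t = t0.
  case: t => [[i k] a] ts /= aE; have := degS _ ts; rewrite /= aE rE //.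
  rewrite ipDl ipMnl bX gX mul0rn addr0 => /esym/eqP; rewrite pnatr_eq1 => /eqP i1.
  move: ts; rewrite smem => /and3P[_ _ /eqP] /=; rewrite aE rE // i1 mulr1n.
  move/addrI/(natmul_vector_inj (root_neq0 (roots_no0 hPhi) g)) => kj.
  by rewrite /t0 -kj; congr (_, _, _); apply: val_inj.
pose k (t : nat * nat * Phi) : C :=
  (c b g t.1.1 t.1.2)%:~R * 1 ^+ t.1.1 * 1 ^+ t.1.2.
(* The terms of degree at least two of [W] are harmless: only the classes modulo
   [filt X 2] matter below. *)
pose W := \sum_(t <- s) (k t * (ip (val t.2) X)%:C) *: e t.2.
set P := (\big[(fun f g => (f \o g)%VF) / \1%VF]_(t <- s) y t.2 (k t)) z.
have PE : P - (z + W) \in filt X 2.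
  apply: product_weight_vector => // t ts; rewrite degS // ler1n.
  by move: ts; case: t => [[i l] a]; rewrite smem => /and3P[].
have comm : y b 1 (y g 1 z) = y g 1 (y b 1 P).
  have gb : val g != val b by rewrite eq_sym.
  have gNb : val g != - val b by rewrite -eqr_oppLR eq_sym.
  have := cF b g gb gNb s sP 1 1 => /(congr1 (fun f : 'End(L) => f z)).
  rewrite /lfun_commutator !comp_lfunE -/P => <-.
  by rewrite !(root_automorphismK hPhi ipP adP cb).
have g0 : 0 <= ip (val g) X by rewrite gX.
have b0 : 0 <= ip (val b) X by rewrite bX.
have WF : W \in filt X 1.
  rewrite /W big_seq; apply: rpred_sum => u us; apply: rpredZ.
  apply: root_vector_filtration; rewrite degS // ler1n.
  by move: us; case: u => [[i l] a]; rewrite smem => /and3P[].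
pose w := e b + W.
have ebF : e b \in filt X 1 by apply: root_vector_filtration; rewrite bX.
have wF : w \in filt X 1 by rewrite rpredD.
have key : y g 1 w - e b \in filt X 2.
  have bP : y b 1 P - (z + w) \in filt X 2.
    have -> : P = (P - (z + W)) + z + W by rewrite -addrA subrK.
    rewrite 2!linearD /= (exp_weight_vector zX) // bX mulr1 scale1r.
    set Pd := P - (z + W); set v := y b 1 Pd.
    have -> : v + (z + e b) + y b 1 W - (z + w) = v + (y b 1 W - W).
      rewrite /w [z + (_ + _)]addrA; set u := z + e b.
      by rewrite opprD [LHS]addrA [v + u + _]addrAC addrK addrA.
    apply: rpredD; first exact: (filtration_exp_stable ipP adP cb).
    have := filtration_exp ipP adP cb 1 b0 WF.
    by apply: (subvP (degree_filtration_le _ _ _ _ _)); rewrite bX; lra.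
  move: comm; rewrite (exp_weight_vector zX g 1 z0) gX mulr0 scale0r addr0.
  rewrite (exp_weight_vector zX) // bX mulr1 scale1r.
  have -> : y b 1 P = (y b 1 P - (z + w)) + z + w by rewrite -addrA subrK.
  rewrite 2!linearD /= (exp_weight_vector zX g 1 z0) gX mulr0 scale0r addr0.
  set v := y b 1 P - _ in bP *; rewrite addrAC [_ + z]addrC => /addrI ->.
  rewrite opprD [_ + (_ - _)]addrCA subrr addr0 rpredN.
  exact: (filtration_exp_stable ipP adP cb).
(* As [b] is the origin of the string, the structure constants along the string
   are [1, 2, ...] up to the signs [eps]. *)
have /choice[eps epsP] k' : exists ep : C, (k' < j)%N ->
    (ep = 1 \/ ep = -1) /\
    ad (e g) (e (r k')) = (ep * k'.+1%:R) *: e (r k'.+1).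
  have [kj|kj] := ltnP k' j; last by exists 0.
  have rS : val (r k'.+1) = val g + val (r k').
    by rewrite !rE ?(ltnW kj) // mulrS addrCA.
  have [p [pP pmax adE]] := cb_sum cb rS.
  have pk : p = k'.
    apply/eqP; rewrite eqn_leq; apply/andP; split; rewrite leqNgt; apply/negP => lt.
      have := origin (p - k')%N; rewrite subn_gt0 lt => /(_ isT) /negP[].
      move: pP; rewrite rE ?(ltnW kj) // mulrnBr ?(ltnW lt) // opprB.
      by rewrite addrA addrAC.
    have := pmax k' lt; rewrite rE ?(ltnW kj) // addrK => /negP[]; exact: valP.
  rewrite pk in adE; case: adE => ->; [exists 1 | exists (-1)] => _; split.
  - by left.
  - by rewrite mul1r.
  - by right.
  - by rewrite mulN1r scaleNr.
(* The products [eta] of the signs turn the coordinates along the string into the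
   divided powers of [ad e_g]. *)
pose eta m : C := \prod_(i < m) eps i.
have etaS m : eta m.+1 = eta m * eps m by rewrite /eta big_ord_recr.
have etaP m : (m <= j)%N -> eta m = 1 \/ eta m = -1.
  elim: m => [|m IH] mj; first by left; rewrite /eta big_ord0.
  rewrite etaS; have [[->|->] _] := epsP m mj; have [->|->] := IH (ltnW mj);
    rewrite ?mulr1 ?mulrN1 ?opprK; by [left|right].
have /choice[co coP] m := root_coordinate cb (r m).
pose q m v : C := eta m * co m v.
have rinj m a : (m <= j)%N -> val g + val a = val (r m) -> (0 < m)%N /\ a = r m.-1.
  case: m => [|m] mj aE.
    have /negP[] := origin 1%N isT; rewrite mulr1n -[val b]addr0.
    have -> : val b + 0 - val g = val a; last exact: valP.
    by rewrite -(mulr0n (val g)) -rE // -aE addrAC subrr add0r.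
  split=> //; apply: val_inj; apply: (addrI (val g)).
  by rewrite aE /= !rE ?(ltnW mj) // mulrS addrCA.
have brk m a : (m <= j)%N -> 1 <= ip (val a) X ->
    co m (ad (e g) (e a)) =
    if (0 < m)%N && (a == r m.-1) then eps m.-1 * m%:R else 0.
  move=> mj aX; have aNg : val a != - val g.
    by apply: contraTneq aX => ->; rewrite ipNl gX oppr0 -ltNge ltr01.
  case: ifP => [/andP[m0 /eqP ->]|nm].
    have mj' : (m.-1 < j)%N by rewrite prednK.
    have [_ ->] := epsP _ mj'; rewrite linearZ /= coP prednK // eqxx.
    by rewrite -[LHS]/(_ * _) mulr1.
  have [gaP|gaP] := boolP (val g + val a \in Phi); last first.
    by rewrite (cb_zero cb) // linear0.
  have [p [_ _ adE]] := cb_sum cb (g := [` gaP]%fset) (erefl : _ = val g + val a).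
  have co0 : co m (e [` gaP]%fset) = 0.
    rewrite coP; case: eqP => // gaE.
    have := rinj m a mj; rewrite -gaE => /(_ erefl)[m0 am].
    by rewrite m0 am eqxx in nm.
  by case: adE => ->; rewrite ?linearN linearZ /= co0 scaler0 ?oppr0.
have fF u : u \in filt X 1 -> (1 *: ad (e g)) u \in filt X 1.
  move=> uF; rewrite scale1r.
  by have := bracket_filtration ipP adP cb g uF; rewrite gX addr0.
have jL : (j <= \dim {:L})%N.
  have := size_basis (X := in_tuple _) (cb_basis cb) => ->.
  rewrite size_cat !size_map; apply: leq_trans (leq_addl _ _).
  have rI : injective (fun i : 'I_j => r i).
    move=> i i' /(congr1 val); rewrite !rE ?(ltnW (ltn_ord _)) // => /addrI.
    by move/(natmul_vector_inj (root_neq0 (roots_no0 hPhi) g))/val_inj.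
  by have := leq_card _ rI; rewrite card_ord cardT enumT.
have qF m : (m <= j)%N -> scalar (q m).
  by move=> _ a u v; rewrite /q linearP mulrDr mulrCA.
have q0 u : u \in filt X 1 -> q 0%N ((1 *: ad (e g)) u) = 0.
  move=> uF; rewrite scale1r /q.
  suff : (co 0%N \o ad (e g))%VF u \in 0%VS.
    by rewrite memv0 comp_lfunE => /eqP ->; rewrite mulr0.
  apply: (degree_filtration_ind _ _ uF) => a aX; first by move: aX; rewrite ler10.
  by rewrite comp_lfunE brk // memv0.
have qS m u : (m < j)%N -> u \in filt X 1 ->
    q m.+1 ((1 *: ad (e g)) u) = m.+1%:R * q m u.
  move=> mj uF; rewrite scale1r /q etaS.
  suff : (co m.+1 \o ad (e g) - (eps m * m.+1%:R) *: co m)%VF u \in 0%VS.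
    rewrite memv0 add_lfunE opp_lfunE comp_lfunE scale_lfunE subr_eq0 => /eqP ->.
    rewrite -[_ *: _]/(_ * _).
    by have [[->|->] _] := epsP m mj; ring.
  apply: (degree_filtration_ind _ _ uF) => a aX; first by move: aX; rewrite ler10.
  rewrite memv0 add_lfunE opp_lfunE comp_lfunE scale_lfunE brk //= coP.
  apply/eqP; case: (a =P r m) => _; rewrite -[_ *: _]/(_ * _);
    by rewrite ?mulr1 ?mulr0 subrr.
have co2 m u : (m <= j)%N -> u \in filt X 2 -> co m u = 0.
  move=> mj uF; apply/eqP; rewrite -memv0.
  apply: (degree_filtration_ind _ _ uF) => a aX; first by move: aX; rewrite lern0.
  rewrite coP memv0; case: (a =P r m) aX => [->|]; rewrite ?eqxx //.
  rewrite rE // ipDl ipMnl bX gX.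
  by rewrite mul0rn addr0 leNgt ltr1n.
have rb m : (m <= j)%N -> (b == r m) = (m == 0%N).
  move=> mj; apply/eqP/eqP => [bE|->]; last by rewrite r0.
  apply: (natmul_vector_inj (root_neq0 (roots_no0 hPhi) g)).
  by apply: (addrI (val b)); rewrite mulr0n addr0 -rE // -bE.
have coW m : co m W = \sum_(t <- s) (k t * (ip (val t.2) X)%:C) * (t.2 == r m)%:R.
  by rewrite /W linear_sum; apply: eq_bigr => t _; rewrite linearZ /= coP.
have inv m : (m <= j)%N -> q m w = (-1) ^+ m.
  apply: (binomial_inversion (d := fun m => q m w)) => [|l /andP[l0 lj]].
    rewrite /q /eta big_ord0 mul1r linearD /= coP r0 eqxx coW.
    rewrite big_seq big1 ?addr0 //.
    move=> t ts; case: eqP => [tb|_]; last by rewrite mulr0.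
    move: ts (degS _ ts); rewrite tb r0 bX; case: t tb => [[i l] a] /= ->.
    rewrite smem r0 => /and3P[_ l0 /eqP] + /esym/eqP.
    rewrite pnatr_eq1 => + /eqP i1.
    rewrite i1 mulr1n -[LHS]addr0 -(mulr0n (val g)) => /addrI.
    move=> /(natmul_vector_inj (root_neq0 (roots_no0 hPhi) g)) l00.
    by rewrite -l00 in l0.
  have fact0 i : i`!%:R != 0 :> C by rewrite pnatr_eq0 -lt0n fact_gt0.
  rewrite -(nilpotent_exp_string fact0 fF jL qF q0 qS lj wF).
  rewrite -[nilpotent_exp _](_ : y g 1 = _) // -[y g 1 w](subrK (e b)).
  rewrite /q linearD /=.
  by rewrite (co2 _ _ lj key) coP rb // gtn_eqF // add0r mulr0.
have := inv j (leqnn _).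
have -> : q j w = eta j * (c b g 1%N j)%:~R.
  rewrite /q /w linearD /= coP rb // gtn_eqF // add0r coW.
  rewrite (bigD1_seq t0) //= big_seq_cond big1 ?addr0 => [|t /andP[ts tt0]].
    have -> : ip (fsval (r j)) X = 1 by have := degS t0 t0s.
    by rewrite eqxx /k /= !expr1n !mulr1.
  case: eqP => [tr|_]; last by rewrite mulr0.
  by rewrite (inj t ts) ?tr ?eqxx in tt0.
have sgn (i : int) : (i%:~R = 1 :> C -> i = 1) /\ (i%:~R = -1 :> C -> i = -1).
  split=> ie; apply: (@intr_inj C); rewrite ie ?rmorphN1 //.
have [s1 s2] := sgn (c b g 1%N j).
have [|] := etaP j (leqnn _) => ->; rewrite ?mul1r ?mulN1r -signr_odd;
  case: (odd j); rewrite ?expr0 ?expr1.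
- by move/s2; right.
- by move/s1; left.
- by move/oppr_inj/s1; left.
- by move/eqP; rewrite eqr_oppLR => /eqP/s2; right.
Qed.

End StringConstants.

(** * Steinberg groups *)

Section RootCombinations.
Variables (R : realType) (E : vectType R) (Phi : {fset E}).
Hypothesis Phi0 : 0 \notin Phi.
Hypothesis PhiL : one_per_line Phi.

Lemma roots_independent (a b : Phi) (r t : R) :
  val b != val a -> val b != - val a -> r *: val a + t *: val b = 0 ->
  r = 0 /\ t = 0.
Proof.
move=> ba bNa e; have t0 : t = 0.
  apply: contraTeq ba => t0; rewrite negbK.
  have bE : val b = (- (r / t)) *: val a.
    apply: (scalerI t0); rewrite scalerA mulrN mulrCA mulfV // mulr1 scaleNr.
    by apply/eqP; rewrite -addr_eq0 addrC e.
  by have [->//|bN] := PhiL bE; rewrite bN eqxx in bNa.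
split=> //; apply/eqP; move: e; rewrite t0 scale0r addr0 => /eqP.
by rewrite scaler_eq0 (negPf (root_neq0 Phi0 a)) orbF.
Qed.

Lemma root_combination_inj (a b : Phi) (i j k l : nat) :
  val b != val a -> val b != - val a ->
  val a *+ i + val b *+ j = val a *+ k + val b *+ l -> i = k /\ j = l.
Proof.
move=> ba bNa e.
have [] := @roots_independent a b (i%:R - k%:R) (j%:R - l%:R) ba bNa.
  rewrite !scalerBl !scaler_nat addrACA -opprD e subrr //.
by move=> /eqP + /eqP; rewrite !subr_eq0 !eqr_nat => /eqP + /eqP.
Qed.

Lemma root_combinations_exist (a b : Phi) : val b != val a -> val b != - val a ->
  exists s, root_combinations a b s.
Proof.
move=> ba bNa.
have /choice[f fP] (g : Phi) : exists o : option (nat * nat * Phi),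
    oapp snd g o = g /\ forall i j, (o = Some (i, j, g)) <->
    [&& (0 < i)%N, (0 < j)%N & val g == val a *+ i + val b *+ j].
  have [[[i j] ijg]|none] := pselect (exists ij : nat * nat,
      [&& (0 < ij.1)%N, (0 < ij.2)%N & val g == val a *+ ij.1 + val b *+ ij.2]).
    exists (Some (i, j, g)); split=> // k l.
    split=> [[<- <-]//|/and3P[_ _ /eqP klE]].
    case/and3P: ijg => /= _ _ /eqP; rewrite klE => /esym.
    by move=> /(root_combination_inj ba bNa)[-> ->].
  exists None; split=> // k l; split=> // klg; case: none; by exists (k, l).
pose s0 := pmap f (enum {: Phi}).
pose lt (t u : nat * nat * Phi) := (t.1.1 + t.1.2 <= u.1.1 + u.1.2)%N.
have s0u : uniq s0.
  by apply: (@pmap_uniq _ _ _ snd) (enum_uniq _) => g; case: (fP g).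
have s0m i j g : ((i, j, g) \in s0) =
    [&& (0 < i)%N, (0 < j)%N & val g == val a *+ i + val b *+ j].
  rewrite mem_pmap; apply/mapP/idP => [[g' _ fg]|ijg].
    have [gg /(_ i j)] := fP g'; rewrite -fg /= in gg *; rewrite -gg.
    by move=> -[+ _]; apply.
  by exists g; rewrite ?mem_enum //; have [_ /(_ i j)[_ /(_ ijg)]] := fP g.
exists (sort lt s0); split.
- by rewrite sort_uniq.
- by move=> i j g; rewrite mem_sort s0m.
- by apply: sort_sorted => t u; exact: leq_total.
Qed.

End RootCombinations.

Section SteinbergGroup.
Variables (R : realType) (E : vectType R) (Phi : {fset E}).
Variables (c : Phi -> Phi -> nat -> nat -> int) (A : comPzRingType).

Local Notation x := (@root_elt R E Phi c A).
Local Notation rel := (@steinberg_rel R E Phi c A).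

Lemma presented_mulE (u v : word (Phi * A)%type) :
  (pr rel u * pr rel v)%g = pr rel (u ++ v).
Proof. exact: pr_mul. Qed.

Lemma presented_invE (u : word (Phi * A)%type) :
  ((pr rel u)^-1)%g = pr rel (inv_word u).
Proof. exact: pr_inv. Qed.

Lemma steinberg_add a p q : x a (p + q) = (x a p * x a q)%g.
Proof.
by rewrite /root_elt presented_mulE; apply/esym/prP/WordRel/SteinbergAdd.
Qed.

Definition commutator_word (a b : Phi) (p q : A) (s : seq (nat * nat * Phi)) :
  seq (Phi * A) :=
  [seq (t.2, (c a b t.1.1 t.1.2)%:~R * p ^+ t.1.1 * q ^+ t.1.2) | t <- s].

Lemma steinberg_commutator (a b : Phi) p q s :
  val b != - val a -> root_combinations a b s ->
  ((x a p)^-1 * (x b q)^-1 * x a p * x b q)%g =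
  root_word x (commutator_word a b p q s).
Proof.
move=> baN sP; rewrite /root_elt !presented_invE.
have mulE4 (u v w t : word (Phi * A)%type) :
    (pr rel u * pr rel v * pr rel w * pr rel t)%g = pr rel (u ++ v ++ w ++ t).
  rewrite (presented_mulE u v) (presented_mulE (u ++ v) w).
  by rewrite (presented_mulE ((u ++ v) ++ w) t) -!catA.
rewrite mulE4.
have -> w : root_word x w = pr rel (flatten [seq root_letter t.1 t.2 | t <- w]).
  elim: w => [|t w IH]; first by rewrite /root_word big_nil.
  by rewrite /root_word big_cons -/(root_word x w) IH /root_elt presented_mulE.
by apply/prP; rewrite -map_comp; apply: WordRel; exact: SteinbergComm.
Qed.

Lemma root_word_cat w1 w2 :
  root_word x (w1 ++ w2) = (root_word x w1 * root_word x w2)%g.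
Proof. by rewrite /root_word big_cat. Qed.

Lemma root_wordV w :
  ((root_word x w)^-1)%g = root_word x (rev [seq (t.1, - t.2) | t <- w]).
Proof.
have x0 a : x a 0 = 1%g.
  by apply: (mulgI (x a 0)); rewrite -steinberg_add addr0 mulg1.
have xV a p : ((x a p)^-1)%g = x a (- p).
  by apply: (mulgI (x a p)); rewrite mulgV -steinberg_add subrr x0.
elim: w => [|t w IH]; first by rewrite /root_word !big_nil invg1.
rewrite /= rev_cons -cats1 root_word_cat -IH /root_word big_cons invgM.
by rewrite big_seq1 xV.
Qed.

Lemma steinberg_generated (g : Steinberg c A) : exists w, g = root_word x w.
Proof.
rewrite -[g](pr_repr (rel := rel)).
elim: (repr g) => [|[[a p] b] u [w uw]].
  by exists [::]; rewrite /root_word big_nil.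
have -> : pr rel (((a, p), b) :: u) = (pr rel [:: ((a, p), b)] * pr rel u)%g.
  by rewrite presented_mulE.
rewrite uw; case: b.
  exists ((a, - p) :: w); rewrite -[_ :: w]cat1s root_word_cat; congr (_ * _)%g.
  transitivity ((root_word x [:: (a, p)])^-1)%g; last by rewrite root_wordV.
  by rewrite /root_word big_seq1 /= /root_elt presented_invE.
exists ((a, p) :: w); rewrite -[_ :: w]cat1s root_word_cat.
by congr (_ * _)%g; rewrite /root_word big_seq1.
Qed.

Hypotheses (hPhi : root_system Phi) (hcl : classical Phi) (hred : reduced Phi).
Hypotheses (hirr : irreducible Phi) (hrank : (2 <= \dim (fullv : {vspace E}))%N).
Hypothesis hc : chevalley_constants c.

(** Every root [a] is [b + j g] for a root [b] that is the origin of its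
    [g]-string.  The commutator of [x_b] and [x_g] contains [x_a] with exponent
    linear in the parameter of [x_b] and coefficient a sign, so that it can be
    solved for [x_a]. *)
Lemma steinberg_core (a : Phi) : exists M : nat, forall p, exists w,
  [/\ (size w <= M)%N, x a p = root_word x w &
    forall t, t \in w -> val t.1 != val a /\ val t.1 != - val a].
Proof.
have [ip ipP] := hcl; have PhiL := one_root_per_line hPhi hred.
have Phi0 := roots_no0 hPhi.
have [g [ga gNa ag]] := nonorthogonal_root ip hPhi hirr hrank a.
have [b [j [j0 aE string origin]]] := root_string_origin hPhi hred ipP ga gNa ag.
have gprop r : val a <> r *: val g.
  move=> /PhiL[] e; first by rewrite e eqxx in ga.
  by rewrite e opprK eqxx in gNa.
have bg : val b != val g.
  apply/eqP => e; apply: (gprop j.+1%:R).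
  by rewrite aE e scaler_nat mulrS.
have bNg : val b != - val g.
  apply/eqP => e; apply: (gprop (j%:R - 1)).
  by rewrite aE e scalerBl scaler_nat scale1r addrC.
have gb : val g != val b by rewrite eq_sym.
have gNb : val g != - val b by rewrite -eqr_oppLR eq_sym.
have [s sP] := root_combinations_exist Phi0 PhiL gb gNb.
have sign : c b g 1%N j = 1 \/ c b g 1%N j = -1.
  have [L [ad [H [wt [Delta [h [e [adP [_ [_ [_ [cb cF]]]]]]]]]]]] := hc.
  exact: (string_constant hPhi hred ipP adP cb cF bg bNg j0 string origin sP).
have [suniq smem _] := sP.
have ts : (1%N, j, a) \in s by rewrite smem j0 /= aE mulr1n.
pose away (d : Phi) := val d != val a /\ val d != - val a.
have baway : away b.
  split; apply/eqP => e.
    move: aE; rewrite e -[LHS]addr0 => /addrI/esym/eqP.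
    rewrite -scaler_nat scaler_eq0 (negPf (root_neq0 Phi0 g)) orbF pnatr_eq0.
    by move=> /eqP j00; rewrite j00 in j0.
  apply: (gprop (j%:R / 2)); apply: (@scalerI _ _ (2 : R)) => //.
  rewrite scalerA mulrCA mulfV // mulr1 !scaler_nat mulr2n {1}aE e.
  by rewrite addrAC addNr add0r.
have saway t : t \in s -> t != (1%N, j, a) -> away t.2.
  case: t => [[i k] d] /[dup] ds; rewrite smem => /and3P[i0 k0 /eqP /= dE] ne.
  split; apply/eqP => e.
    move: dE; rewrite e aE -[val b in LHS]mulr1n.
    move=> /(root_combination_inj Phi0 PhiL gb gNb)[i1 kj].
    by case/eqP: ne; rewrite -i1 -kj; congr (_, _, _); exact: val_inj.
  have [] := @roots_independent _ _ _ Phi0 PhiL b g (i + 1)%:R (k + j)%:R gb gNb.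
    by rewrite !scaler_nat !mulrnDr addrACA -dE e mulr1n -aE addNr.
  by move=> /eqP; rewrite pnatr_eq0 addn1.
exists (size s + 4)%N => p.
(* The sign cancels against the constant in the factor of root [a]. *)
pose p1 : A := (c b g 1%N j)%:~R * p.
pose W := commutator_word b g p1 1.
pose inv (w : seq (Phi * A)) := rev [seq (t.1, - t.2) | t <- w].
have comm := steinberg_commutator p1 1 gNb sP.
have [s1 [s2 sE]] : exists s1 s2, s = s1 ++ (1%N, j, a) :: s2.
  by case/splitPr: ts => s1 s2; exists s1, s2.
have Waway s' : (forall t, t \in s' -> t \in s /\ t != (1%N, j, a)) ->
    forall t, t \in inv (W s') -> away t.1.
  move=> s'P t; rewrite mem_rev => /mapP[_ /mapP[u us' ->] ->] /=.
  by have [us une] := s'P u us'; exact: saway une.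
exists (inv (W s1) ++ [:: (b, - p1); (g, -1); (b, p1); (g, 1)] ++ inv (W s2)).
split.
- by rewrite !size_cat !size_rev !size_map sE size_cat /=; lia.
- rewrite !root_word_cat -!root_wordV.
  have -> : root_word x [:: (b, - p1); (g, -1); (b, p1); (g, 1)] =
      ((x b p1)^-1 * (x g 1)^-1 * x b p1 * x g 1)%g.
    have xV d r : ((x d r)^-1)%g = x d (- r).
      have := root_wordV [:: (d, r)].
      by rewrite /root_word !big_seq1.
    by rewrite !xV /root_word !big_cons big_nil /= mulg1 !mulgA.
  rewrite comm sE /commutator_word map_cat /= -!/(commutator_word _ _ _ _ _).
  rewrite -cat1s !root_word_cat /root_word big_seq1 /= -!/(root_word _ _).
  rewrite -!mulgA mulgV mulg1 mulKg expr1 expr1n mulr1 /p1 mulrA -intrM.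
  have -> : c b g 1%N j * c b g 1%N j = 1 by case: sign => ->.
  by rewrite mul1r.
- move: suniq; rewrite sE cat_uniq /= => /and3P[_ /norP[s1a _] /andP[s2a _]].
  move=> t; rewrite mem_cat => /orP[|].
    apply: Waway => u us1; split; first by rewrite sE mem_cat us1.
    by apply: contraNneq s1a => <-.
  rewrite (mem_cat _ [:: _; _; _; _]) => /orP[|].
    by rewrite !inE => /or4P[] /eqP -> //=; split=> //; rewrite eq_sym.
  apply: Waway => u us2; split; first by rewrite sE mem_cat inE us2 !orbT.
  by apply: contraNneq s2a => <-.
Qed.

Lemma steinberg_strongly_graded : strongly_graded x.
Proof.
split; first exact: steinberg_add; last exact: steinberg_generated;
  last exact: steinberg_core.
move=> a b p q ba bNa; have PhiL := one_root_per_line hPhi hred.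
have ab : val a != val b by rewrite eq_sym.
have aNb : val a != - val b by rewrite -eqr_oppLR eq_sym.
have [s sP] := root_combinations_exist (roots_no0 hPhi) PhiL ab aNb.
exists (commutator_word b a q p s); split.
  by rewrite -(steinberg_commutator q p aNb sP) !mulgA mulgK mulgV mul1g.
move=> _ /mapP[[[i j] d] ts ->] /=; have [_ smem _] := sP.
by move: ts; rewrite smem => /and3P[i0 j0 /eqP dE]; exists i, j.
Qed.

End SteinbergGroup.

(** * The fixed point property of Steinberg groups *)

Theorem theorem1p5 (R : realType) (E : vectType R) (Phi : {fset E})
    (hPhi : root_system Phi) (hcl : classical Phi) (hred : reduced Phi)
    (hirr : irreducible Phi) (hrank : (2 <= \dim (fullv : {vspace E}))%N)
    (c : Phi -> Phi -> nat -> nat -> int) (hc : chevalley_constants c)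
    (A : comPzRingType)
    (hrel : forall a : Phi,
       relative_F (@uniformly_convex R) (@root_subgroup R E Phi c A a)) :
  property_F (@uniformly_convex R) (@Steinberg R E Phi c A).
Proof.
move=> V ucV rho rhoP.
have xP := steinberg_strongly_graded A hPhi hcl hred hirr hrank hc.
have [a0V a0P] : exists v, v \in Phi by apply/fset0Pn; case: hPhi.
have PhiL := one_root_per_line hPhi hred.
have [f [fP fC]] := wall_functionals (roots_no0 hPhi) PhiL.
have /choice[v vP] (a : Phi) : exists v, forall p, rho (root_elt c a p) v = v.
  by have [v vP] := hrel a V ucV rho rhoP; exists v => p; apply: vP; exists p.
apply: (global_fixed_point xP ucV rhoP fP fC [` a0P]%fset
  (o := 0) (d := \sum_a 2 * `|v a|)) => a p.
apply: (@le_trans _ _ (0 + 2 * `|0 - v a|)).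
  apply: (almost_fixed_near rhoP (u := v a)).
    by rewrite /almost_fixed vP subrr normr0.
  by rewrite distrC.
rewrite add0r sub0r normrN (bigD1 a) //= lerDl.
by apply: sumr_ge0 => b _; rewrite mulr_ge0.
Qed.
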